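(* Let $n\ge 0$ be an integer, let $a_1,\ldots,a_n$ be positive integers, and let $a_0$ be a non-negative integer. If $n$ is even, then $$\phi([a_0;a_1,\ldots,a_{n-1},a_n])=(-A^3)^{a_0-a_1+\cdots-a_{n-1}+a_n}\,\langle T([a_0;a_1,\ldots,a_{n-1},a_n])\rangle ,$$ and if $n$ is odd, then $$\phi([a_0;a_1,\ldots,a_n])=(-A^3)^{a_0-a_1+\cdots-a_n+2}\,\langle T([a_0;a_1,\ldots,a_n])\rangle .$$ (The exponents are the alternating sum $\sum_{i=0}^n(-1)^ia_i$, respectively $2+\sum_{i=0}^n(-1)^ia_i$.)
   Context: Notation. $\Lambda=\mathbb{Z}[A,A^{-1}]$, $\delta=-A^2-A^{-2}$, and $\Lambda^2=\Lambda[\infty]\oplus\Lambda[0]$ is the free $\Lambda$-module with basis $[\infty],[0]$. $[a_0;a_1,\ldots,a_n]=a_0+\cfrac{1}{a_1+\cfrac{1}{\ddots+\cfrac1{a_n}}}$. Farey sums. Irreducible fractions have non-negative denominator, with $0=\frac01$, $\infty=\frac10$. Fractions $\frac pq,\frac rs$ (listed in ascending order) are Farey neighbors if $qr-ps=1$; their Farey sum is $\frac pq\sharp\frac rs=\frac{p+r}{q+s}$. Each positive rational $\alpha$ is $y\sharp z$ for a unique pair $(y,z)$ of Farey neighbors, called the pair of parents of $\alpha$. Ancestor triangle. Let $\alpha$ be a positive rational. Put $(y_1,z_1)=(\frac01,\frac10)$ and $m_i=y_i\sharp z_i$. If $m_i=\alpha$ stop and put $N=i$; otherwise $(y_{i+1},z_{i+1})=(m_i,z_i)$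 if $\alpha>m_i$ and $(y_i,m_i)$ if $\alpha<m_i$. The ancestor triangle of $\alpha$ is the planar triangle with upper left corner $\frac01$, upper right corner $\frac10$ and bottom corner $\alpha$, decomposed into the $N$ fundamental triangles with vertices $y_i$ (upper left), $z_i$ (upper right), $m_i$ (bottom), $i=1,\ldots,N$, the $(i+1)$-st glued below the $i$-th along the edge $y_{i+1}z_{i+1}$. Its left oblique side is the chain of edges through the distinct $y_i$'s from $\frac01$ down to $\alpha$, and its right oblique side is the chain of edges through the distinct $z_i$'s from $\frac10$ down to $\alpha$; $l(\alpha)$, $r(\alpha)$ are the numbers of edges on the left and right oblique sides. For $\ast\in\{0,\infty\}$, $P_\ast(\alpha)$ is the set of descending paths from $\ast$ to $\alpha$, i.e. edge paths in the ancestor triangle in which each step goes from a vertex to a vertex of which it is a parent. Such a path $\gamma$ cuts the ancestor triangle into a left and a right part; $w_L(\gamma)$, $w_R(\gamma)$ are the numbers of fundamental triangles on the left and on the right of $\gamma$. The map $\phi$ from the non-negative rationals together with $\infty$ to $\Lambda^2$ is defined by $\phi(\infty)=A^6[\infty]$, $\phi(0)=[0]$ and, for rational $\alpha>0$, $$\phi(\alpha)=\Bigl(A^6(-A^4)^{-r(\alpha)}\sum_{\gamma\in P_\infty(\alpha)}(-A^4)^{w_R(\gamma)}\Bigr)[\infty]+\Bigl((-A^4)^{l(\alpha)}\sum_{\gamma\in P_0(\alpha)}(-A^4)^{-w_L(\gamma)}\Bigr)[0].$$ Tangles. $[0]$ is the tangle diagram of two horizontal arcs and $[\infty]$ that of two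 vertical arcs. The Kauffman bracket $\langle T\rangle=n_T[\infty]+d_T[0]\in\Lambda^2$ of a tangle diagram $T$ is computed by the skein rule (crossing) $=A$(one smoothing) $+A^{-1}$(other smoothing) and removal of a disjoint circle with factor $\delta$. The diagram $[1]$ is the single crossing with $\langle[1]\rangle=A^{-1}[\infty]+A[0]$. The sum $T\bowtie U$ (horizontal juxtaposition) and product $T\ast U$ (vertical stacking) satisfy $d_{T\bowtie U}=d_Td_U$, $n_{T\bowtie U}=n_Td_U+d_Tn_U+n_Tn_U\delta$, $d_{T\ast U}=d_Tn_U+n_Td_U+d_Td_U\delta$, $n_{T\ast U}=n_Tn_U$. For a positive integer $k$, $[k]=[1]\bowtie\cdots\bowtie[1]$ and $\frac1{[k]}=[1]\ast\cdots\ast[1]$ ($k$ factors); $\frac{1}{[0]}=[\infty]$. Rational tangle diagram $T(\frac pq)$. For a non-negative rational $\frac pq$, write $\frac pq=[b_0;b_1,\ldots,b_m]$ with $m$ even, $b_0\ge0$ and $b_1,\ldots,b_m\ge1$ (such an expansion is unique). Then $T(\frac pq)$ is the standard rational tangle diagram built from $[b_m]$ by successively taking the product with $\frac1{[b_{m-1}]}$, the sum with $[b_{m-2}]$, the product with $\frac{1}{[b_{m-3}]}$, and so on, ending with the sum with $[b_0]$. In particular, when $n$ is odd in the claim, $T([a_0;a_1,\ldots,a_n])$ denotes the diagram of the rational number with that value, built from its expansion of even length index. *)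

(* Defs.v *)
From HB Require Import structures.
From mathcomp Require Import all_boot all_order all_algebra.
From mathcomp Require Import zify.
From mathcomp Require Import boolp classical_sets cardinality fsbigop.

Set Implicit Arguments.
Unset Strict Implicit.
Unset Printing Implicit Defensive.

Import Order.TTheory GRing.Theory Num.Theory.
Local Open Scope ring_scope.

Local Notation "x %:F" := (tofrac x).

(* It is realized as the subring of the field of fractions of Z[X] formed by
   the elements p / X^n, with A = X.  The comUnitRingType structure (inverses
   of the units of the ring itself) makes integer powers [u ^ k] available. *)
Definition is_laurent : {pred {fraction {poly int}}} :=
  fun x => `[< exists (p : {poly int}) (n : nat), x = p%:F / 'X%:F ^+ n >].

Lemma fracX_neq0 : ('X : {poly int})%:F != 0 :> {fraction {poly int}}.
Proof. by rewrite tofrac_eq0 polyX_eq0. Qed.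

Fact is_laurent_subring : subring_closed is_laurent.
Proof.
have Xn n : ('X : {poly int})%:F ^+ n != 0 :> {fraction {poly int}}.
  by rewrite expf_neq0 // fracX_neq0.
split.
- by apply/asboolP; exists 1, 0%N; rewrite expr0 divr1 tofrac1.
- move=> x y /asboolP[p [m ->]] /asboolP[q [n ->]]; apply/asboolP.
  exists (p * 'X^n - q * 'X^m), (m + n)%N.
  rewrite exprD tofracB !tofracM !tofracXn mulrBl.
  by rewrite invfM !mulrA mulfK // [_ * _^-1 * _^-1]mulrAC mulfK.
- move=> x y /asboolP[p [m ->]] /asboolP[q [n ->]]; apply/asboolP.
  by exists (p * q), (m + n)%N; rewrite exprD tofracM invfM mulrACA.
Qed.

HB.instance Definition _ :=
  GRing.isSubringClosed.Build {fraction {poly int}} is_laurent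
    is_laurent_subring.

Record laurent := Laurent { laurent_val : {fraction {poly int}};
                            laurent_valP : laurent_val \in is_laurent }.

HB.instance Definition _ := [isSub for laurent_val].
HB.instance Definition _ := [Choice of laurent by <:].
HB.instance Definition _ := [SubChoice_isSubComNzRing of laurent by <:].

Definition laurent_unit : {pred laurent} :=
  fun x => (val x != 0) && ((val x)^-1 \in is_laurent).
Definition laurent_inv (x : laurent) : laurent :=
  if x \in laurent_unit then insubd x (val x)^-1 else x.

Fact laurent_mulVx : {in laurent_unit, left_inverse 1 laurent_inv *%R}.
Proof.
move=> x xU; apply: val_inj; rewrite /laurent_inv xU rmorphM rmorph1.
by case/andP: xU => x0 xV; rewrite /= val_insubd xV mulVf.
Qed.

Fact laurent_unitPl (x y : laurent) : y * x = 1 -> laurent_unit x.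
Proof.
move=> yx.
have yx1 : val y * val x = 1 by rewrite -[LHS](rmorphM val) yx rmorph1.
have x0 : val x != 0.
  by apply/eqP => x0; move/eqP: yx1; rewrite x0 mulr0 eq_sym oner_eq0.
rewrite /laurent_unit x0 /=.
by rewrite -[_^-1]mul1r -yx1 mulfK //; exact: valP.
Qed.

Fact laurent_inv_out : {in [predC laurent_unit], laurent_inv =1 id}.
Proof. by move=> x /negbTE; rewrite /laurent_inv => ->. Qed.

HB.instance Definition _ := GRing.ComNzRing_hasMulInverse.Build laurent
  laurent_mulVx laurent_unitPl laurent_inv_out.

Fact laurent_A_subproof : ('X : {poly int})%:F \in is_laurent.
Proof. by apply/asboolP; exists 'X, 0%N; rewrite expr0 divr1. Qed.
Definition A : laurent := Laurent laurent_A_subproof.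

Lemma A_unit : A \is a GRing.unit.
Proof.
apply/andP; split; first exact: fracX_neq0.
by apply/asboolP; exists 1, 1%N; rewrite tofrac1 mul1r expr1.
Qed.

Definition delta : laurent := - A ^+ 2 - A ^- 2.

(* Coordinates are relative to the basis [oo], [0]. *)
Definition laurent2 : Type := (laurent^o * laurent^o)%type.
HB.instance Definition _ := GRing.Lmodule.on laurent2.
Definition basis_inf : laurent2 := (1, 0).
Definition basis_0 : laurent2 := (0, 1).

(* p/q is represented by the pair (p, q); only irreducible pairs are used. *)
Definition farey : Type := (nat * nat)%type.
HB.instance Definition _ := Choice.on farey.
Definition f0 : farey := (0, 1)%N.
Definition finf : farey := (1, 0)%N.
Definition flt (x y : farey) : bool := (x.1 * y.2 < y.1 * x.2)%N.
Definition farey_sum (x y : farey) : farey := (x.1 + y.1, x.2 + y.2)%N.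
Definition farey_of_rat (r : rat) : farey := (`|numq r|, `|denq r|)%N.

(* A fundamental triangle is given by its upper vertices (y, z); its bottom
   vertex is y # z. *)
Definition triangle : Type := (farey * farey)%type.
Definition bottom (t : triangle) : farey := farey_sum t.1 t.2.

(* The triangles (y_1, z_1), ..., (y_N, z_N).  The first argument bounds the
   number of steps; p + q steps are enough for p/q > 0 because numerator plus
   denominator of m_i is at least i + 1, see [ancestors_bottom]. *)
Fixpoint descent (fuel : nat) (alpha : farey) (t : triangle) : seq triangle :=
  if fuel is k.+1 then
    let m := bottom t in
    t :: (if m == alpha then [::]
          else if flt m alpha then descent k alpha (m, t.2)
          else descent k alpha (t.1, m))
  else [::].
Definition ancestors (alpha : farey) : seq triangle :=
  descent (alpha.1 + alpha.2) alpha (f0, finf).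

Lemma descent_bottom fuel s t (y z : farey) :
  (0 < s)%N -> (0 < t)%N -> coprime s t -> (s + t <= fuel.+1)%N ->
  (y.2 * z.1 = y.1 * z.2 + 1)%N ->
  let alpha : farey := (s * y.1 + t * z.1, s * y.2 + t * z.2)%N in
  bottom (last (f0, finf) (descent fuel alpha (y, z))) = alpha.
Proof.
case: y z => [a b] [c d] /=.
elim: fuel s t a b c d (f0, finf) => [|k IH] s t a b c d x s0 t0 st le_st yz.
  by case: s s0 le_st {st} => [|s] //; case: t t0 => [|t] //; rewrite addnS.
rewrite /=; case: eqP => [|/eqP neq] //.
have -> : flt (bottom ((a, b), (c, d))) (s * a + t * c, s * b + t * d)%N
          = (s < t)%N.
  by rewrite /flt /=; apply/idP/idP; nia.
case: ltngtP => [lt_st|lt_ts|eq_st].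
- have -> : (s * a + t * c = s * (a + c) + (t - s) * c)%N by nia.
  have -> : (s * b + t * d = s * (b + d) + (t - s) * d)%N by nia.
  apply: IH => //; rewrite ?subn_gt0 //; [|lia|nia].
  by rewrite /coprime -(gcdnDr s) subnK ?(ltnW lt_st).
- have -> : (s * a + t * c = (s - t) * a + t * (a + c))%N by nia.
  have -> : (s * b + t * d = (s - t) * b + t * (b + d))%N by nia.
  apply: IH => //; rewrite ?subn_gt0 //; [|lia|nia].
  by rewrite coprime_sym /coprime -(gcdnDr t) subnK ?(ltnW lt_ts) // gcdnC.
- move: st neq; rewrite -eq_st /coprime gcdnn => /eqP ->.
  by rewrite !mul1n /bottom /farey_sum /= eqxx.
Qed.

Lemma ancestors_bottom (alpha : farey) :
  (0 < alpha.1)%N -> (0 < alpha.2)%N -> coprime alpha.1 alpha.2 ->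
  bottom (last (f0, finf) (ancestors alpha)) = alpha.
Proof.
case: alpha => p q /= p0 q0 pq.
have := @descent_bottom (p + q) q p f0 finf q0 p0.
rewrite /= !muln0 !muln1 !add0n addn0 addnC => -> //.
by rewrite coprime_sym.
Qed.

(* An edge is the pair of its endpoints listed in ascending order. *)
Definition edge : Type := (farey * farey)%type.
Definition chain_edges (s : seq farey) : seq edge :=
  [seq (if flt e.1 e.2 then e else (e.2, e.1)) | e <- zip s (behead s)].
Definition triangle_edges (t : triangle) : seq edge :=
  [:: (t.1, t.2); (t.1, bottom t); (bottom t, t.2)].

Definition left_side (alpha : farey) : seq farey :=
  rcons (undup [seq t.1 | t <- ancestors alpha]) alpha.
Definition right_side (alpha : farey) : seq farey :=
  rcons (undup [seq t.2 | t <- ancestors alpha]) alpha.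
Definition nb_left (alpha : farey) : nat := size (chain_edges (left_side alpha)).
Definition nb_right (alpha : farey) : nat :=
  size (chain_edges (right_side alpha)).

Definition is_parent (alpha x w : farey) : bool :=
  has (fun t => (w == bottom t) && ((x == t.1) || (x == t.2)))
    (ancestors alpha).

(* A path is the list of all its vertices. *)
Definition descending_paths (star alpha : farey) : set (seq farey) :=
  [set g | [/\ ohead g = Some star, sorted (is_parent alpha) g
             & last star g = alpha]].

Lemma is_parent_ltn (alpha x w : farey) :
  is_parent alpha x w -> (x.1 + x.2 < w.1 + w.2)%N.
Proof.
pose ok (t : triangle) := (0 < t.1.1 + t.1.2)%N && (0 < t.2.1 + t.2.2)%N.
have okd fuel a t : ok t -> all ok (descent fuel a t).
  elim: fuel t => [|k IH] [[a1 a2] [b1 b2]] //= okt.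
  move: (okt); rewrite {1}/ok /= => /andP[ha hb]; rewrite okt /=.
  by case: ifP => // _; case: ifP => _; apply: IH; rewrite /ok /=; lia.
case/hasP=> -[[a1 a2] [b1 b2]] tin /andP[/eqP-> /orP[]/eqP->] /=;
  have /allP/(_ _ tin) := okd (alpha.1 + alpha.2)%N alpha (f0, finf) isT;
  by rewrite /ok /=; lia.
Qed.

(* Hence the finite-support sums over descending paths below are actual sums. *)
Lemma finite_descending_paths (star alpha : farey) :
  finite_set (descending_paths star alpha).
Proof.
pose M := (alpha.1 + alpha.2).+1.
pose f (v : 'I_M * 'I_M) : farey := (v.1 : nat, v.2 : nat).
apply: (@sub_finite_set _ _
  [set map f b | b in [set: {bseq M of 'I_M * 'I_M}]]%classic); last first.
  exact: finite_image.
move=> g [/= hd gs gl].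
have sg : sorted ltn [seq (v.1 + v.2)%N | v : farey <- g].
  by apply: homo_sorted gs => x w; apply: is_parent_ltn.
have gM v : v \in g -> (v.1 + v.2 < M)%N.
  move: hd gl sg; case/lastP: g {gs} => // g w _; rewrite last_rcons => ->.
  rewrite map_rcons -cats1 (sorted_pairwise ltn_trans) pairwise_cat.
  move=> /andP[/allrelP h _]; rewrite mem_rcons inE => /orP[/eqP->|vg] //.
  have := h (v.1 + v.2)%N (alpha.1 + alpha.2)%N; rewrite mem_seq1 eqxx.
  by move=> /(_ _ isT) lt_v; apply/ltnW/lt_v/mapP; exists v.
have sizeg : (size g <= M)%N.
  rewrite -(size_map (fun v : farey => v.1 + v.2)%N) -[M in leqRHS](size_iota 0).
  apply: uniq_leq_size; first exact: (sorted_uniq ltn_trans ltnn).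
  by move=> _ /mapP[v vg ->]; rewrite mem_iota /= add0n gM.
pose h (v : farey) : 'I_M * 'I_M := (inord v.1, inord v.2).
have sb : (size (map h g) <= M)%N by rewrite size_map.
exists (Bseq sb) => //=; rewrite -map_comp -[RHS]map_id; apply/eq_in_map => v vg.
have := gM v vg; case: v {vg} => a b /= lt_ab.
by rewrite /f /h /= !inordK //; lia.
Qed.

(* Two fundamental triangles are adjacent off g if they share an edge that is
   not on g.  The part of the ancestor triangle on one side of g consists of the
   fundamental triangles from which one reaches, without crossing g, an edge of
   the corresponding oblique side. *)
Definition adjacent_off (g : seq farey) (t u : triangle) : bool :=
  has (fun e => (e \in triangle_edges u) && (e \notin chain_edges g))
    (triangle_edges t).
Definition touches_off (g side : seq farey) (t : triangle) : bool :=
  has (fun e => (e \in chain_edges side) && (e \notin chain_edges g))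
    (triangle_edges t).
Definition part (alpha : farey) (side g : seq farey) :
    {set 'I_(size (ancestors alpha))} :=
  let T i := tnth (in_tuple (ancestors alpha)) i in
  [set i | [exists j, connect (fun a b => adjacent_off g (T a) (T b)) i j
                      && touches_off g side (T j)]].
Definition w_left (alpha : farey) (g : seq farey) : nat :=
  #|part alpha (left_side alpha) g|.
Definition w_right (alpha : farey) (g : seq farey) : nat :=
  #|part alpha (right_side alpha) g|.

Definition phi_pos (alpha : farey) : laurent2 :=
  (A ^+ 6 * (- A ^+ 4) ^- nb_right alpha *
     \sum_(g \in descending_paths finf alpha) (- A ^+ 4) ^+ w_right alpha g)
    *: basis_inf
  + ((- A ^+ 4) ^+ nb_left alpha *
     \sum_(g \in descending_paths f0 alpha) (- A ^+ 4) ^- w_left alpha g)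
    *: basis_0.

(* [None] is oo; the value at negative rationals is irrelevant. *)
Definition phi (x : option rat) : laurent2 :=
  match x with
  | None => A ^+ 6 *: basis_inf
  | Some r => if r == 0 then basis_0 else phi_pos (farey_of_rat r)
  end.

(* A diagram is encoded by a finite set of points of the underlying curves,
   among them the four end points, together with
   - plain strands, each joining two points and free of crossings;
   - crossings (a, b, c, d), each a small disk with the points a, b, c, d at its
     NW, NE, SW, SE corners, where the disk is turned so that the smoothing
     joining a-b and c-d is the one weighted by A in the skein rule. *)
Record diagram := Diagram {
  pts : finType;
  nw : pts; ne : pts; sw : pts; se : pts;
  strands : seq (pts * pts);
  crossings : seq (pts * pts * pts * pts) }.

Section Bracket.
Variable D : diagram.
Implicit Type S : seq (pts D * pts D).

Definition joined S : rel (pts D) :=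
  connect (fun x y => ((x, y) \in S) || ((y, x) \in S)).

Definition circles S : nat :=
  #|[set [set y | joined S x y] | x in
      [pred x | ~~ has (joined S x) [:: nw D; ne D; sw D; se D]]]|.

(* Without crossings, a planar diagram is [0] or [oo] plus circles. *)
Definition bracket_flat S : laurent2 :=
  delta ^+ circles S *:
    (if joined S (nw D) (ne D) then basis_0 else basis_inf).

Fixpoint bracket_rec S (C : seq (pts D * pts D * pts D * pts D)) :
    laurent2 :=
  if C is (a, b, c, d) :: C' then
    A *: bracket_rec [:: (a, b), (c, d) & S] C'
    + A^-1 *: bracket_rec [:: (a, c), (b, d) & S] C'
  else bracket_flat S.

Definition bracket : laurent2 := bracket_rec (strands D) (crossings D).
End Bracket.

(* Corners are encoded as (is it north?, is it west?). *)
Definition cNW : bool * bool := (true, true).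
Definition cNE : bool * bool := (true, false).
Definition cSW : bool * bool := (false, true).
Definition cSE : bool * bool := (false, false).

Definition tangle_0 : diagram :=
  @Diagram (bool * bool)%type cNW cNE cSW cSE
    [:: (cNW, cNE); (cSW, cSE)] [::].
Definition tangle_inf : diagram :=
  @Diagram (bool * bool)%type cNW cNE cSW cSE
    [:: (cNW, cSW); (cNE, cSE)] [::].
Definition tangle_1 : diagram :=
  @Diagram (bool * bool)%type cNW cNE cSW cSE
    [::] [:: (cNW, cNE, cSW, cSE)].

Definition map_strand (P Q : Type) (f : P -> Q) (e : P * P) : Q * Q :=
  (f e.1, f e.2).
Definition map_crossing (P Q : Type) (f : P -> Q) (c : P * P * P * P) :
    Q * Q * Q * Q :=
  let: (x, y, z, t) := c in (f x, f y, f z, f t).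

(* T to the left of U *)
Definition tangle_sum (T U : diagram) : diagram :=
  let l : pts T -> pts T + pts U := inl in
  let r : pts U -> pts T + pts U := inr in
  @Diagram (pts T + pts U)%type
    (l (nw T)) (r (ne U)) (l (sw T)) (r (se U))
    ([:: (l (ne T), r (nw U)); (l (se T), r (sw U))]
       ++ map (map_strand l) (strands T) ++ map (map_strand r) (strands U))
    (map (map_crossing l) (crossings T) ++ map (map_crossing r) (crossings U)).

(* T above U *)
Definition tangle_prod (T U : diagram) : diagram :=
  let l : pts T -> pts T + pts U := inl in
  let r : pts U -> pts T + pts U := inr in
  @Diagram (pts T + pts U)%type
    (l (nw T)) (l (ne T)) (r (sw U)) (r (se U))
    ([:: (l (sw T), r (nw U)); (l (se T), r (ne U))]
       ++ map (map_strand l) (strands T) ++ map (map_strand r) (strands U))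
    (map (map_crossing l) (crossings T) ++ map (map_crossing r) (crossings U)).

Definition tangle_int (k : nat) : diagram :=
  if k is k'.+1 then iter k' (tangle_sum^~ tangle_1) tangle_1 else tangle_0.
Definition tangle_inv (k : nat) : diagram :=
  if k is k'.+1 then iter k' (tangle_prod^~ tangle_1) tangle_1 else tangle_inf.

(* Meaningful for lists of odd size b_0, ..., b_m (m even). *)
Fixpoint tangle_of_seq (b : seq nat) : diagram :=
  match b with
  | [:: b0, b1 & b'] =>
      tangle_sum (tangle_prod (tangle_of_seq b') (tangle_inv b1))
                 (tangle_int b0)
  | [:: b0] => tangle_int b0
  | [::] => tangle_0
  end.

Fixpoint cfrac (b : seq nat) : rat :=
  match b with
  | [::] => 0
  | [:: b0] => b0%:R
  | b0 :: b' => b0%:R + (cfrac b')^-1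
  end.

(* b = b_0, ..., b_m with m even and b_1, ..., b_m >= 1 *)
Definition even_expansion_of (b : seq nat) (r : rat) : Prop :=
  [/\ odd (size b), all (leq 1) (behead b) & cfrac b = r].

(* Euclid's algorithm on (p, q); the first argument only needs to exceed q. *)
Fixpoint euclid (fuel p q : nat) : seq nat :=
  if fuel is k.+1 then
    if q == 0%N then [::] else (p %/ q)%N :: euclid k q (p %% q)%N
  else [::].

(* If Euclid's expansion has even size then its last term is at least 2 and is
   split as (b - 1) + 1/1. *)
Definition even_expansion (r : rat) : seq nat :=
  let b := euclid (`|denq r|).+1 `|numq r| `|denq r| in
  if odd (size b) then b
  else rcons (rcons (take (size b).-1 b) (last 0%N b).-1) 1%N.

Lemma cfrac_cons b0 b : cfrac (b0 :: b) = b0%:R + (cfrac b)^-1.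
Proof. by case: b => //=; rewrite invr0 addr0. Qed.

Lemma cfrac_rcons1 b k : cfrac (rcons (rcons b k) 1%N) = cfrac (rcons b k.+1).
Proof.
elim: b => [|b0 b IH]; first by rewrite /= invr1 natr1.
by rewrite !rcons_cons !cfrac_cons IH.
Qed.

Lemma euclidP fuel p q (b := euclid fuel p q) : (0 < q < fuel)%N ->
  [/\ b != [::], cfrac b = p%:R / q%:R, all (leq 1) (behead b),
      (q <= p -> 0 < head 0 b)%N
    & ((1 < size b) || (q < p) -> 1 < last 0 b)%N].
Proof.
rewrite {}/b; elim: fuel p q => [|k IH] p q; first by rewrite ltn0 andbF.
case/andP=> q0 le_qk /=; rewrite (gtn_eqF q0).
have q0' : q%:R != 0 :> rat by rewrite pnatr_eq0 -lt0n.
have [r0|r0] := posnP (p %% q).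
  have -> : euclid k q (p %% q) = [::] by rewrite r0; case: (k).
  have Ep : p = (p %/ q * q)%N by rewrite {1}(divn_eq p q) r0 addn0.
  split=> //=.
  - by rewrite [in RHS]Ep natrM mulfK.
  - by rewrite divn_gt0.
  - by rewrite [in X in X -> _]Ep -{1}[q]mul1n ltn_pmul2r.
have lt_rq : (p %% q < q)%N by rewrite ltn_mod.
have [|n0 Eb bpos hpos lpos] := IH q (p %% q)%N.
  by rewrite r0 (leq_trans lt_rq).
split=> //.
- rewrite -/(cfrac (_ :: _)) cfrac_cons Eb invf_div.
  by rewrite [in RHS](divn_eq p q) natrD natrM mulrDl mulfK.
- move: n0 bpos (hpos (ltnW lt_rq)).
  by case: (euclid _ _ _) => //= b0 b _ -> ->.
- by rewrite /= divn_gt0.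
- move=> _ /=; move: n0 lpos; rewrite lt_rq orbT => n0 /(_ isT).
  by case: (euclid _ _ _) n0.
Qed.

Lemma even_expansionP (r : rat) :
  0 <= r -> even_expansion_of (even_expansion r) r.
Proof.
move=> r0; set p := `|numq r|%N; set q := `|denq r|%N.
have q0 : (0 < q)%N by rewrite absz_gt0 denq_neq0.
have Er : r = p%:R / q%:R.
  rewrite /p /q !natr_absz ger0_norm ?numq_ge0 // gtr0_norm ?denq_gt0 //.
  by rewrite divq_num_den.
have [|n0 Eb bpos _ lpos] := @euclidP q.+1 p q; first by rewrite q0 /=.
rewrite /even_expansion -/p -/q; set b := euclid _ _ _ in n0 Eb bpos lpos *.
case: ifP => [odd_b|even_b]; first by split; rewrite ?Eb.
case/lastP: b n0 Eb bpos lpos even_b => // b x _ Eb bpos lpos even_b.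
rewrite size_rcons /= in even_b; rewrite last_rcons size_rcons in lpos *.
have -> : take (size b).+1.-1 (rcons b x) = b by rewrite -cats1 take_size_cat.
case: b Eb bpos lpos even_b => [//|b0 b] Eb bpos lpos even_b.
move: (lpos isT) => x1; split.
- by rewrite !size_rcons /= negbK; move: even_b => /= /negbFE.
- move: bpos; rewrite /= !all_rcons => /andP[_ ->]; rewrite andbT /=.
  by case: x x1 {Eb lpos} => [|[]].
- by rewrite cfrac_rcons1 prednK ?(ltnW x1) // Eb.
Qed.

Definition rational_tangle (r : rat) : diagram :=
  tangle_of_seq (even_expansion r).

(* Main.v *)
Require Import Defs.
From HB Require Import structures.
From mathcomp Require Import all_boot all_order all_algebra.
From mathcomp Require Import zify ring lra.
From mathcomp Require Import boolp classical_sets fsbigop.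

Set Implicit Arguments.
Unset Strict Implicit.
Unset Printing Implicit Defensive.

Import Order.TTheory GRing.Theory Num.Theory.
Local Open Scope ring_scope.

(** Write (n, d) for n [oo] + d [0].  Both sides of the identity are computed
from the expansion b_0, ..., b_m (m even) by iterating the same two linear
maps, starting from [0]:

  plus_one (n, d) = (n - A^2 d, -A^4 d),
  inv_plus_one (n, d) = (-A^-4 n, d - A^-2 n).

Tangle side.  Adding one crossing on the right of a diagram acts on the
bracket, up to the factor -A^3, by plus_one; adding one below acts, up to the
inverse factor, by inv_plus_one.  The rational diagram is built by b_m, ...,
b_0 such operations, alternately on the right and below, so that
(-A^3)^(b_0 - b_1 + ... + b_m) <T> is the result of applying the two maps in
turn (bracket_tangle_of_seq).  This rests on the formulas for the bracket of a
sum and of a product (bracket_sum, bracket_prod).  A diagram is a graph here,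
so these formulas are about connected components: in each smoothing state the
four ends are paired either horizontally or vertically, a state has two
components more than it has circles, and adding an edge merges two components
or none.

Fraction side.  One has phi (x + 1) = plus_one (phi x) and
phi (x / (x + 1)) = inv_plus_one (phi x) for x > 0 (phi_word_true,
phi_word_false), while phi 1 = plus_one [0].  A positive rational is recorded
by the word of turns made on the way down to it, and prefixing a letter to the
word puts one more fundamental triangle on top of the ancestor triangle.  A
descending path in the taller triangle either steps from its starting vertex to
the bottom of the new triangle, or goes on in the old triangle from a corner
that both triangles share.  A fundamental triangle lies on the right of a path
exactly if the last vertex of the path older than the bottom of that triangle
is its upper left corner (side_of); this is local enough to follow the widths
through the recursion, and it shows that the widths on the two sides add up to
the number N of fundamental triangles.  The constants agree because
l + r = N + 1.

The two sides meet in phi_bracket.  The expansion of even length index being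
unique, it is the given one when n is even; when n is odd it arises from the
given one by writing the last entry a_n as (a_n - 1) + 1/1, or by absorbing it
into a_(n-1) if a_n = 1.  Either change raises the alternating sum by 2. *)

(** * Connected components *)

Section Components.
Variable D : diagram.
Implicit Types (S : seq (pts D * pts D)) (a b x y : pts D).

Let edge_rel S : rel (pts D) := fun x y => ((x, y) \in S) || ((y, x) \in S).

Lemma joined_refl S x : joined S x x.
Proof. exact: connect0. Qed.

Lemma joined_sym S x y : joined S x y = joined S y x.
Proof.
have esym : symmetric (edge_rel S) by move=> u v; rewrite /edge_rel orbC.
exact: (sym_connect_sym esym).
Qed.

Lemma joined_trans S y x z : joined S x y -> joined S y z -> joined S x z.
Proof. exact: connect_trans. Qed.

Lemma eq_joined S S' : S =i S' -> joined S =2 joined S'.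
Proof. by move=> eqS x y; apply: eq_connect => u v; rewrite !eqS. Qed.

Lemma joined_nil x y : joined [::] x y = (x == y).
Proof.
apply/idP/eqP => [/connectP[[|z p] //=]|->]; last exact: joined_refl.
Qed.

(** A path through the new strand can be cut at its last use of that strand, so
it uses it at most once. *)
Lemma joined_cons S a b x y :
  joined ((a, b) :: S) x y =
  [|| joined S x y, joined S x a && joined S b y
    | joined S x b && joined S a y].
Proof.
have sub u v : joined S u v -> joined ((a, b) :: S) u v.
  apply: connect_sub => {}u {}v uv; apply: connect1.
  by rewrite !inE; case/orP: uv => ->; rewrite !orbT.
have ab : joined ((a, b) :: S) a b by apply: connect1; rewrite inE eqxx.
apply/idP/idP; last first.
  case/or3P => [/sub //|/andP[/sub xa /sub b_y]|/andP[/sub xb /sub ay]].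
    exact: joined_trans xa (joined_trans ab b_y).
  by apply: joined_trans xb (joined_trans _ ay); rewrite joined_sym.
case/connectP=> p; elim: p x => [x _ ->|z p IH x /= /andP[xz pz] ey].
  by rewrite joined_refl.
have /or3P H := IH z pz ey.
have : [|| joined S x z, (x == a) && (z == b) | (x == b) && (z == a)].
  move: xz; rewrite !inE !xpair_eqE.
  case/orP=> /orP[/andP[-> ->]|xz]; rewrite ?orbT //.
    by apply/orP; left; apply: connect1; rewrite xz.
  by apply/orP; left; apply: connect1; rewrite xz orbT.
case/or3P => [{}xz|/andP[/eqP -> /eqP zb]|/andP[/eqP -> /eqP za]].
- case: H => [zy|/andP[za b_y]|/andP[zb ay]].
  + by rewrite (joined_trans xz zy).
  + by rewrite (joined_trans xz za) b_y orbT.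
  + by rewrite (joined_trans xz zb) ay !orbT.
- rewrite {}zb in H *; rewrite !joined_refl /=.
  by case: H => [->|/andP[_ ->]|/andP[_ ->]]; rewrite ?orbT.
- rewrite {}za in H *; rewrite !joined_refl /=.
  by case: H => [->|/andP[_ ->]|/andP[_ ->]]; rewrite ?orbT.
Qed.

Definition component S x : {set pts D} := [set y | joined S x y].
Definition components S : {set {set pts D}} := [set component S x | x : pts D].

Lemma eq_component S x y : (component S x == component S y) = joined S x y.
Proof.
apply/eqP/idP => [/setP/(_ y)|xy]; first by rewrite !inE joined_refl.
apply/setP => z; rewrite !inE; apply/idP/idP; last exact: joined_trans xy.
by apply: joined_trans; rewrite joined_sym.
Qed.

Lemma card_components_nil : #|components [::]| = #|pts D|.
Proof.
rewrite card_imset // => x y /eqP.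
by rewrite eq_component joined_nil => /eqP.
Qed.

(** A strand between two components merges them: sending each component other
than that of [b] to itself, enlarged by the component of [b] if it contains
[a], is a bijection onto the new components. *)
Lemma card_components_cons S a b :
  #|components S| = (#|components ((a, b) :: S)| + ~~ joined S a b)%N.
Proof.
have [ab|ab] /= := boolP (joined S a b).
  rewrite addn0 /components.
  suff -> : component S = component ((a, b) :: S) by [].
  apply/funext => x; apply/setP => y; rewrite !inE joined_cons.
  case: (boolP (joined S x y)) => //= xy; apply/esym/norP; split.
    by apply: contra xy => /andP[/joined_trans H /(joined_trans ab)]; apply: H.
  apply: contra xy => /andP[/joined_trans H]; apply: joined_trans.
  by apply: H; rewrite joined_sym.
pose merge (C : {set pts D}) := if a \in C then C :|: component S b else C.
have mergeE x : ~~ joined S x b ->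
  merge (component S x) = component ((a, b) :: S) x.
  move=> xb; apply/setP => y; rewrite [RHS]inE joined_cons (negPf xb) orbF /merge inE.
  by case: ifP; rewrite !inE //= ?orbF.
have -> : components ((a, b) :: S) = merge @: (components S :\ component S b).
  apply/setP => C; apply/imsetP/imsetP => [[x _ ->]|[C']].
    have [xb|xb] := boolP (joined S x b).
      exists (component S a); first by rewrite !inE eq_component ab imset_f.
      rewrite mergeE //; apply/eqP; rewrite eq_component joined_cons xb.
      by rewrite joined_refl /= !orbT.
    exists (component S x); first by rewrite !inE eq_component xb imset_f.
    by rewrite mergeE.
  rewrite !inE => /andP[nb /imsetP[x _ eC]] ->; rewrite eC eq_component in nb *.
  by exists x; rewrite ?mergeE.
rewrite [in RHS]card_in_imset; last first.
  move=> C C'; rewrite !inE => /andP[nb /imsetP[x _ eC]] /andP[nb' /imsetP[y _ eC']].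
  rewrite eC eq_component in nb *; rewrite eC' eq_component in nb' *.
  rewrite !mergeE // => /eqP; rewrite eq_component joined_cons (negPf nb) orbF.
  rewrite (joined_sym S b y) (negPf nb') andbF orbF => xy.
  by apply/eqP; rewrite eq_component.
have bS : component S b \in components S by exact: imset_f.
by rewrite (cardsD1 (component S b)) bS addnC.
Qed.

End Components.

(** * States of a diagram without crossings *)

Definition corner (D : diagram) (c : bool * bool) : pts D :=
  if c.1 then if c.2 then nw D else ne D
  else if c.2 then sw D else se D.
Arguments corner : simpl never.

(** [h = true] means that the ends are paired as in the tangle [0], and
[h = false] as in [oo].  Planarity enters only through this condition: it
excludes a diagonal pairing. *)
Definition has_shape (D : diagram) (S : seq (pts D * pts D)) (h : bool) : Prop :=
  forall c c', joined S (corner D c) (corner D c') =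
    if h then c.1 == c'.1 else c.2 == c'.2.

Definition basis_of_shape (h : bool) : laurent2 := if h then basis_0 else basis_inf.

(** The components that are not circles are those of the four ends, and there
are two of them since the north-west and the south-east ends are never joined.
Circles can thus be counted through components, which behave well under
gluing. *)
Lemma circlesE (D : diagram) (S : seq (pts D * pts D)) h :
  has_shape S h -> #|components S| = (circles S + 2)%N.
Proof.
move=> shS.
have jS c c' := shS c c'.
pose CC := [set component S x | x in
      [pred x | ~~ has (joined S x) [:: nw D; ne D; sw D; se D]]].
have eC : components S = component S (corner D cNW) |:
     (component S (corner D cSE) |: CC).
  apply/setP => C; rewrite !inE; apply/imsetP/idP => [[x _ ->]|]; last first.
    case/or3P => [/eqP ->|/eqP ->|/imsetP[x _ ->]]; last by exists x.
      by exists (corner D cNW).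
    by exists (corner D cSE).
  rewrite !eq_component.
  have [|out] := boolP (has (joined S x) [:: nw D; ne D; sw D; se D]); last first.
    by apply/or3P/Or33/imsetP; exists x.
  have jC c : joined S x (corner D c) ->
      joined S x (corner D cNW) || joined S x (corner D cSE).
    move=> xc; move: (jS c cNW) (jS c cSE).
    case: h {shS jS} c xc => [] [[] []] xc jN jE;
    do ?[by rewrite (joined_trans xc jN)]; by rewrite (joined_trans xc jE) orbT.
  rewrite /= orbF => /or4P H; rewrite orbA; apply/orP; left.
  by case: H => [/(jC cNW)|/(jC cNE)|/(jC cSW)|/(jC cSE)].
have notC c : component S (corner D c) \notin CC.
  apply/imsetP => -[x]; rewrite !inE => out /eqP.
  rewrite eq_component joined_sym => xc; case/negP: out; rewrite /= orbF.
  by case: c xc => [] [] []; rewrite /corner /= => ->; rewrite ?orbT.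
rewrite eC !cardsU1 !inE (negPf (notC cNW)) (negPf (notC cSE)) eq_component.
by rewrite (jS cNW cSE); case: (h); rewrite /= !add1n addn2.
Qed.

Fixpoint all_states (D : diagram) (Q : seq (pts D * pts D) -> Prop) S
    (C : seq (pts D * pts D * pts D * pts D)) : Prop :=
  if C is (a, b, c, d) :: C' then
    all_states Q [:: (a, b), (c, d) & S] C' /\
    all_states Q [:: (a, c), (b, d) & S] C'
  else Q S.

Definition shaped (D : diagram) (S : seq (pts D * pts D)) : Prop :=
  exists h, has_shape S h.
Definition well_shaped (D : diagram) : Prop :=
  all_states (@shaped D) (strands D) (crossings D).

Lemma eq_bracket_flat (D : diagram) (S S' : seq (pts D * pts D)) :
  S =i S' -> bracket_flat S = bracket_flat S'.
Proof.
move=> eqS; rewrite /bracket_flat /circles.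
suff -> : joined S = joined S' by [].
by apply/funext => x; apply/funext => y; apply: eq_joined.
Qed.

(** * The bracket of a sum *)

(** Locked, since otherwise matching a pattern of the form [vec n d] against a
scaled vector or a sum of vectors succeeds by unfolding the module operations on
pairs. *)
HB.lock Definition vec (n d : laurent) : laurent2 := (n, d).
Definition coef_inf (x : laurent2) : laurent := x.1.
Definition coef_0 (x : laurent2) : laurent := x.2.

Lemma vec_eta x : x = vec (coef_inf x) (coef_0 x).
Proof. by rewrite vec.unlock; case: x. Qed.
Lemma coef_inf_vec n d : coef_inf (vec n d) = n.
Proof. by rewrite vec.unlock. Qed.
Lemma coef_0_vec n d : coef_0 (vec n d) = d.
Proof. by rewrite vec.unlock. Qed.
Definition coefE := (coef_inf_vec, coef_0_vec).
Lemma scale_vec (a n d : laurent) : a *: vec n d = vec (a * n) (a * d).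
Proof. by rewrite vec.unlock. Qed.
Lemma add_vec n d n' d' : vec n d + vec n' d' = vec (n + n') (d + d').
Proof. by rewrite vec.unlock. Qed.
Lemma basis_infE : basis_inf = vec 1 0. Proof. by rewrite vec.unlock. Qed.
Lemma basis_0E : basis_0 = vec 0 1. Proof. by rewrite vec.unlock. Qed.
Definition vecE := (scale_vec, add_vec, basis_infE, basis_0E).

Definition bowtie (x y : laurent2) : laurent2 :=
  vec (coef_inf x * coef_0 y + coef_0 x * coef_inf y
       + coef_inf x * coef_inf y * delta)
      (coef_0 x * coef_0 y).

Lemma bowtie_vec n d n' d' :
  bowtie (vec n d) (vec n' d') = vec (n * d' + d * n' + n * n' * delta) (d * d').
Proof. by rewrite /bowtie !coef_inf_vec !coef_0_vec. Qed.

Lemma bowtieDl (a b : laurent) x y z :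
  bowtie (a *: x + b *: y) z = a *: bowtie x z + b *: bowtie y z.
Proof.
rewrite (vec_eta x) (vec_eta y) (vec_eta z) /bowtie ?vecE ?coefE ?vecE.
by congr vec; ring.
Qed.

Lemma bowtieDr (a b : laurent) x y z :
  bowtie z (a *: x + b *: y) = a *: bowtie z x + b *: bowtie z y.
Proof.
rewrite (vec_eta x) (vec_eta y) (vec_eta z) /bowtie ?vecE ?coefE ?vecE.
by congr vec; ring.
Qed.

(** The case of two crossingless states: gluing two vertical pairings closes up
one additional circle. *)
Lemma bowtie_basis h k i j :
  bowtie (delta ^+ i *: basis_of_shape h) (delta ^+ j *: basis_of_shape k) =
  delta ^+ (i + j + (~~ h && ~~ k)) *: basis_of_shape (h && k).
Proof.
rewrite !exprD; case: h k => [] [];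
  rewrite /basis_of_shape /= /bowtie ?vecE ?coefE ?vecE;
  by congr vec; rewrite ?expr0 ?expr1; ring.
Qed.

Section SumOfTangles.
Variables T U : diagram.
Let l : pts T -> pts (tangle_sum T U) := inl.
Let r : pts U -> pts (tangle_sum T U) := inr.

Definition glue : seq (pts (tangle_sum T U) * pts (tangle_sum T U)) :=
  [:: (l (ne T), r (nw U)); (l (se T), r (sw U))].
Definition juxtapose S1 S2 : seq (pts (tangle_sum T U) * pts (tangle_sum T U)) :=
  map (map_strand l) S1 ++ map (map_strand r) S2.

Lemma joined_juxtapose S1 S2 x y :
  joined (juxtapose S1 S2) x y =
  match x, y with
  | inl x, inl y => joined S1 x y
  | inr x, inr y => joined S2 x y
  | _, _ => false
  end.
Proof.
elim: S1 x y => [|[a b] S1 IH] x y; last first.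
  rewrite [juxtapose _ _]/= joined_cons !IH.
  by case: x y => [x|x] [y|y]; rewrite /= ?joined_cons ?andbF ?orbF.
elim: S2 x y => [|[a b] S2 IH] x y; last first.
  rewrite [juxtapose _ _]/= joined_cons !IH.
  by case: x y => [x|x] [y|y]; rewrite /= ?joined_cons ?andbF ?orbF.
by case: x y => [x|x] [y|y]; rewrite joined_nil ?joined_nil.
Qed.

Lemma card_components_juxtapose S1 S2 :
  #|components (juxtapose S1 S2)| = (#|components S1| + #|components S2|)%N.
Proof.
elim: S1 => [|[a b] S1 IH]; last first.
  apply: (@addIn (~~ joined S1 a b)); rewrite addnAC -card_components_cons -IH.
  by rewrite (card_components_cons (juxtapose S1 S2) (l a) (l b)) joined_juxtapose.
elim: S2 => [|[a b] S2 IH]; last first.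
  apply: (@addIn (~~ joined S2 a b)); rewrite -addnA -card_components_cons -IH.
  by rewrite (card_components_cons (juxtapose [::] S2) (r a) (r b)) joined_juxtapose.
by rewrite !card_components_nil card_sum.
Qed.

Lemma corner_sum c :
  corner (tangle_sum T U) c = if c.2 then l (corner T c) else r (corner U c).
Proof. by case: c => [[] []]. Qed.

Lemma glueE : glue =
  [:: (l (corner T cNE), r (corner U cNW)); (l (corner T cSE), r (corner U cSW))].
Proof. by []. Qed.

Lemma has_shape_sum S1 S2 h k : has_shape S1 h -> has_shape S2 k ->
  has_shape (glue ++ juxtapose S1 S2) (h && k).
Proof.
move=> sh1 sh2 c c'; rewrite glueE /= !joined_cons !joined_juxtapose !corner_sum.
case: c c' => [[] []] [[] []]; rewrite /= ?sh1 ?sh2 /=; case: (h); case: (k) => //=.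
Qed.

(** One gluing strand always merges two components; the other one closes a loop,
and merges nothing, exactly if both states are vertical. *)
Lemma circles_sum S1 S2 h k : has_shape S1 h -> has_shape S2 k ->
  circles (glue ++ juxtapose S1 S2) = (circles S1 + circles S2 + (~~ h && ~~ k))%N.
Proof.
move=> sh1 sh2; have := circlesE (has_shape_sum sh1 sh2).
have := circlesE sh1; have := circlesE sh2.
have := card_components_juxtapose S1 S2.
rewrite glueE /=.
rewrite (card_components_cons _ (l (corner T cSE)) (r (corner U cSW))).
rewrite (card_components_cons _ (l (corner T cNE)) (r (corner U cNW))).
have -> : joined (juxtapose S1 S2) (l (corner T cSE)) (r (corner U cSW)) = false.
  by rewrite joined_juxtapose.
have -> : joined ((l (corner T cSE), r (corner U cSW)) :: juxtapose S1 S2)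
    (l (corner T cNE)) (r (corner U cNW)) = ~~ h && ~~ k.
  by rewrite joined_cons !joined_juxtapose /= sh1 sh2; case: (h); case: (k).
by case: (h); case: (k) => /=; lia.
Qed.

End SumOfTangles.

Lemma bracket_flat_shape (D : diagram) (S : seq (pts D * pts D)) h :
  has_shape S h -> bracket_flat S = delta ^+ circles S *: basis_of_shape h.
Proof.
by move=> sh; rewrite /bracket_flat (sh cNW cNE); case: (h).
Qed.

Lemma eq_has_shape (D : diagram) (S S' : seq (pts D * pts D)) h :
  S =i S' -> has_shape S h -> has_shape S' h.
Proof. by move=> eqS sh c c'; rewrite -(eq_joined eqS). Qed.

Lemma eq_shaped_states (D : diagram) S S' C :
  S =i S' -> all_states (@shaped D) S C -> all_states (@shaped D) S' C.
Proof.
elim: C S S' => [|[[[a b] c] d] C IH] S S' eqS.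
  by case=> h sh; exists h; apply: eq_has_shape eqS sh.
by case=> H1 H2; split; [apply: IH H1|apply: IH H2] => e; rewrite !inE eqS.
Qed.

(** The smoothings of a sum list their strands in another order than gluing does,
but only the set of strands matters. *)
Lemma eq_bracket_rec (D : diagram) (S S' : seq (pts D * pts D)) C :
  S =i S' -> bracket_rec S C = bracket_rec S' C.
Proof.
elim: C S S' => [|[[[a b] c] d] C IH] S S' eqS /=; first exact: eq_bracket_flat.
have e1 : [:: (a, b), (c, d) & S] =i [:: (a, b), (c, d) & S'].
  by move=> e; rewrite !in_cons eqS.
have e2 : [:: (a, c), (b, d) & S] =i [:: (a, c), (b, d) & S'].
  by move=> e; rewrite !in_cons eqS.
by rewrite (IH _ _ e1) (IH _ _ e2).
Qed.

Lemma skein_congr (x x' y y' : laurent2) :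
  x = x' -> y = y' -> A *: x + A^-1 *: y = A *: x' + A^-1 *: y'.
Proof. by move=> -> ->. Qed.

Section BracketOfSum.
Variables T U : diagram.
Let l : pts T -> pts (tangle_sum T U) := inl.
Let r : pts U -> pts (tangle_sum T U) := inr.

Lemma bracket_rec_sum S1 S2 C1 C2 :
  all_states (@shaped T) S1 C1 -> all_states (@shaped U) S2 C2 ->
  let S := glue T U ++ juxtapose S1 S2 in
  let C := map (map_crossing l) C1 ++ map (map_crossing r) C2 in
  all_states (@shaped (tangle_sum T U)) S C /\
  bracket_rec S C = bowtie (bracket_rec S1 C1) (bracket_rec S2 C2).
Proof.
elim: C1 S1 => [|[[[a b] c] d] C1 IH1] S1 /=; last first.
  move=> [/IH1 H1 /IH1 H2] sh2.
  have {H1} [st1 br1] := H1 sh2; have {H2} [st2 br2] := H2 sh2.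
  rewrite bowtieDl -br1 -br2; split; first split.
  - by apply: eq_shaped_states st1 => e; rewrite !(inE, mem_cat); do !bool_congr.
  - by apply: eq_shaped_states st2 => e; rewrite !(inE, mem_cat); do !bool_congr.
  - by apply: skein_congr; apply: eq_bracket_rec => e;
      rewrite !(in_cons, mem_cat); do !bool_congr.
elim: C2 S2 => [|[[[a b] c] d] C2 IH2] S2 /=; last first.
  move=> sh1 [/(IH2 _ sh1) [st1 br1] /(IH2 _ sh1) [st2 br2]].
  rewrite bowtieDr -br1 -br2; split; first split.
  - by apply: eq_shaped_states st1 => e; rewrite !(inE, mem_cat); do !bool_congr.
  - by apply: eq_shaped_states st2 => e; rewrite !(inE, mem_cat); do !bool_congr.
  - by apply: skein_congr; apply: eq_bracket_rec => e;
      rewrite !(in_cons, mem_cat); do !bool_congr.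
case=> h sh1 [k sh2]; have sh := has_shape_sum sh1 sh2; split; first by exists (h && k).
rewrite (bracket_flat_shape sh) (circles_sum sh1 sh2).
by rewrite (bracket_flat_shape sh1) (bracket_flat_shape sh2) bowtie_basis.
Qed.

End BracketOfSum.

Lemma bracket_sum T U : well_shaped T -> well_shaped U ->
  well_shaped (tangle_sum T U) /\
  bracket (tangle_sum T U) = bowtie (bracket T) (bracket U).
Proof. by move=> wT wU; apply: bracket_rec_sum wT wU. Qed.

(** * The bracket of a product *)

(** Reflection in the main diagonal.  Crossings keep their encoding: the
smoothing weighted by [A] joins the same points, although it now pairs the
ends in the other direction. *)
Definition transpose (D : diagram) : diagram :=
  @Diagram (pts D) (nw D) (sw D) (ne D) (se D) (strands D) (crossings D).
Definition swap (x : laurent2) : laurent2 := vec (coef_0 x) (coef_inf x).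

Lemma swap_vec n d : swap (vec n d) = vec d n.
Proof. by rewrite /swap coef_inf_vec coef_0_vec. Qed.

Lemma tangle_prod_transpose T U :
  tangle_prod T U = transpose (tangle_sum (transpose T) (transpose U)).
Proof. by []. Qed.

Lemma swap_linear (a b : laurent) x y :
  swap (a *: x + b *: y) = a *: swap x + b *: swap y.
Proof. by rewrite (vec_eta x) (vec_eta y) !(scale_vec, add_vec, swap_vec). Qed.

Lemma has_shape_transpose (D : diagram) (S : seq (pts D * pts D)) h :
  has_shape S h -> @has_shape (transpose D) S (~~ h).
Proof.
move=> sh c c'.
have cE d : corner (transpose D) d = corner D (d.2, d.1) by case: d => [[] []].
by rewrite !cE [LHS]sh /=; case: (h).
Qed.

Lemma bracket_transpose D : well_shaped D ->
  well_shaped (transpose D) /\ bracket (transpose D) = swap (bracket D).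
Proof.
rewrite /well_shaped /bracket /=;
elim: (crossings D) (strands D) => [|[[[a b] c] d] C IH] S.
  case=> h sh; have sh' := has_shape_transpose sh; split; first by exists (~~ h).
  rewrite /= (bracket_flat_shape sh) (bracket_flat_shape sh').
  have -> : @circles (transpose D) S = circles S.
    apply: (@addIn 2); rewrite -(circlesE sh).
    by rewrite -(circlesE sh').
  by case: (h); rewrite /basis_of_shape /= basis_0E basis_infE !scale_vec swap_vec.
case=> /IH[w1 b1] /IH[w2 b2]; split; first by split.
by rewrite /= swap_linear -b1 -b2.
Qed.

Definition star (x y : laurent2) : laurent2 := swap (bowtie (swap x) (swap y)).

Lemma bracket_prod T U : well_shaped T -> well_shaped U ->
  well_shaped (tangle_prod T U) /\
  bracket (tangle_prod T U) = star (bracket T) (bracket U).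
Proof.
move=> /bracket_transpose[wT bT] /bracket_transpose[wU bU].
rewrite tangle_prod_transpose; have [w b] := bracket_sum wT wU.
by have [w' b'] := bracket_transpose w; rewrite b' b bT bU.
Qed.

(** * Twisting by single crossings *)

Lemma card_components_two_strands (D : diagram) (a b c d : pts D) :
  #|pts D| = 4 -> uniq [:: a; b; c; d] -> #|components [:: (a, b); (c, d)]| = 2%N.
Proof.
move=> D4; rewrite /= !inE !negb_or => /and4P[/and3P[ab ac ad] /andP[bc bd] cd _].
have := card_components_cons [::] c d; have := card_components_cons [:: (c, d)] a b.
rewrite joined_cons !joined_nil card_components_nil D4 (negPf ab) (negPf ac) (negPf ad).
by rewrite (negPf cd) /=; lia.
Qed.

(** All states of the three basic diagrams consist of two disjoint strands. *)
Lemma bracket_flat_two_strands (D : diagram) (a b c d : pts D) h :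
  #|pts D| = 4 -> uniq [:: a; b; c; d] -> has_shape [:: (a, b); (c, d)] h ->
  shaped [:: (a, b); (c, d)] /\
  bracket_flat [:: (a, b); (c, d)] = basis_of_shape h.
Proof.
move=> D4 U sh; split; first by exists h.
have c0 : circles [:: (a, b); (c, d)] = 0%N.
  by apply: (@addIn 2); rewrite -(circlesE sh) card_components_two_strands.
by rewrite (bracket_flat_shape sh) c0 expr0 scale1r.
Qed.

Lemma bracket_tangle_0 : well_shaped tangle_0 /\ bracket tangle_0 = basis_0.
Proof.
apply: (@bracket_flat_two_strands tangle_0 _ _ _ _ true) => //.
  by rewrite card_prod card_bool.
by move=> [[] []] [[] []]; rewrite !joined_cons !joined_nil.
Qed.

Lemma bracket_tangle_inf : well_shaped tangle_inf /\ bracket tangle_inf = basis_inf.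
Proof.
apply: (@bracket_flat_two_strands tangle_inf _ _ _ _ false) => //.
  by rewrite card_prod card_bool.
by move=> [[] []] [[] []]; rewrite !joined_cons !joined_nil.
Qed.

Lemma bracket_tangle_1 :
  well_shaped tangle_1 /\ bracket tangle_1 = vec A^-1 A.
Proof.
have D4 : #|pts tangle_1| = 4 by rewrite card_prod card_bool.
have [] := @bracket_flat_two_strands tangle_1 cNW cNE cSW cSE true D4 isT.
  by move=> [[] []] [[] []]; rewrite !joined_cons !joined_nil.
have [] := @bracket_flat_two_strands tangle_1 cNW cSW cNE cSE false D4 isT.
  by move=> [[] []] [[] []]; rewrite !joined_cons !joined_nil.
move=> w1 b1 w2 b2; split; first by split.
rewrite /bracket /= b1 b2 /basis_of_shape basis_0E basis_infE !scale_vec add_vec.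
by rewrite !mulr0 !mulr1 add0r addr0.
Qed.

Lemma bowtieA x y z : bowtie (bowtie x y) z = bowtie x (bowtie y z).
Proof.
by rewrite (vec_eta x) (vec_eta y) (vec_eta z) !bowtie_vec; congr vec; ring.
Qed.
Lemma bowtie0 x : bowtie x basis_0 = x.
Proof. by rewrite (vec_eta x) basis_0E bowtie_vec; congr vec; ring. Qed.
Lemma bowtie0l x : bowtie basis_0 x = x.
Proof. by rewrite (vec_eta x) basis_0E bowtie_vec; congr vec; ring. Qed.

Lemma swapK x : swap (swap x) = x.
Proof. by rewrite (vec_eta x) !swap_vec. Qed.
Lemma swap_basis_0 : swap basis_0 = basis_inf.
Proof. by rewrite basis_0E swap_vec basis_infE. Qed.
Lemma starA x y z : star (star x y) z = star x (star y z).
Proof. by rewrite /star !swapK bowtieA. Qed.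
Lemma star_inf x : star x basis_inf = x.
Proof. by rewrite /star -swap_basis_0 swapK bowtie0 swapK. Qed.
Lemma star_infl x : star basis_inf x = x.
Proof. by rewrite /star -swap_basis_0 swapK bowtie0l swapK. Qed.

Lemma bracket_tangle_int k : well_shaped (tangle_int k) /\
  bracket (tangle_int k) = iter k (bowtie^~ (vec A^-1 A)) basis_0.
Proof.
have [w1 b1] := bracket_tangle_1.
case: k => [|k]; first exact: bracket_tangle_0.
rewrite iterSr bowtie0l /=; elim: k => [|k [w IH]] //=.
by have [w' b'] := bracket_sum w w1; rewrite b' IH b1.
Qed.

Lemma bracket_tangle_inv k : well_shaped (tangle_inv k) /\
  bracket (tangle_inv k) = iter k (star^~ (vec A^-1 A)) basis_inf.
Proof.
have [w1 b1] := bracket_tangle_1.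
case: k => [|k]; first exact: bracket_tangle_inf.
rewrite iterSr star_infl /=; elim: k => [|k [w IH]] //=.
by have [w' b'] := bracket_prod w w1; rewrite b' IH b1.
Qed.

(** The effect on [phi] of replacing [x] by [x + 1]; by [bowtie_1] it is also that
of a crossing added on the right, up to a factor. *)
Definition plus_one (x : laurent2) : laurent2 :=
  vec (coef_inf x - A ^+ 2 * coef_0 x) (- A ^+ 4 * coef_0 x).
(** The effect on [phi] of replacing [x] by [1 / (1 + 1 / x)], and that of a
crossing added below, up to a factor. *)
Definition inv_plus_one (x : laurent2) : laurent2 :=
  vec ((- A ^+ 4)^-1 * coef_inf x) (coef_0 x - A ^- 2 * coef_inf x).

Lemma A_mulV : A * A^-1 = 1.
Proof. by rewrite mulrV // A_unit. Qed.

(** The coefficient of [n] in [oo] is [A + A^-1 delta = - A^-3], which is why the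
normalizing factor is [- A^3]. *)
Lemma bowtie_1 x : - A ^+ 3 *: bowtie x (vec A^-1 A) = plus_one x.
Proof.
rewrite (vec_eta x) bowtie_vec scale_vec /plus_one !coef_inf_vec !coef_0_vec.
have := A_mulV; rewrite /delta -exprVn; set B := A^-1 => AB.
by congr vec; ring: AB.
Qed.

Lemma star_1 x : (- A ^+ 3)^-1 *: star x (vec A^-1 A) = inv_plus_one x.
Proof.
rewrite (vec_eta x) /star (swap_vec (coef_inf x)) (swap_vec A^-1).
rewrite bowtie_vec swap_vec scale_vec /inv_plus_one !coef_inf_vec !coef_0_vec.
have := A_mulV; rewrite /delta !invrN -!exprVn; set B := A^-1 => AB.
by congr vec; ring: AB.
Qed.

(** * The bracket of a rational tangle *)

Fixpoint alt_sum (b : seq nat) : int :=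
  if b is b0 :: b' then b0%:Z - alt_sum b' else 0.

Fixpoint iterated_twist (b : seq nat) : laurent2 :=
  match b with
  | [:: b0, b1 & b'] =>
      iter b0 plus_one (iter b1 inv_plus_one (iterated_twist b'))
  | [:: b0] => iter b0 plus_one basis_0
  | [::] => basis_0
  end.

Lemma writhe_unit : - A ^+ 3 \is a GRing.unit.
Proof. by rewrite unitrN unitrX // A_unit. Qed.

Lemma bowtieZl (a : laurent) x y : bowtie (a *: x) y = a *: bowtie x y.
Proof. by rewrite -[a *: x]addr0 -[0](scale0r x) bowtieDl scale0r addr0. Qed.
Lemma swapZ (a : laurent) x : swap (a *: x) = a *: swap x.
Proof. by rewrite -[a *: x]addr0 -[0](scale0r x) swap_linear scale0r addr0. Qed.
Lemma starZl (a : laurent) x y : star (a *: x) y = a *: star x y.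
Proof. by rewrite /star swapZ bowtieZl swapZ. Qed.

Lemma bowtie_int x k :
  (- A ^+ 3) ^+ k *: bowtie x (bracket (tangle_int k)) = iter k plus_one x.
Proof.
have [_ ->] := bracket_tangle_int k; elim: k => [|k IH].
  by rewrite expr0 scale1r bowtie0.
by rewrite !iterS -IH -bowtie_1 bowtieZl bowtieA scalerA exprS.
Qed.

Lemma star_inv x k :
  (- A ^+ 3) ^- k *: star x (bracket (tangle_inv k)) = iter k inv_plus_one x.
Proof.
have [_ ->] := bracket_tangle_inv k; elim: k => [|k IH].
  by rewrite expr0 invr1 scale1r star_inf.
by rewrite !iterS -IH -star_1 starZl starA scalerA -!exprVn exprS.
Qed.

Lemma bracket_tangle_of_seq (b : seq nat) :
  well_shaped (tangle_of_seq b) /\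
  (- A ^+ 3) ^ alt_sum b *: bracket (tangle_of_seq b) = iterated_twist b.
Proof.
have [n] := ubnP (size b); elim: n b => [|n IH] [|b0 [|b1 b]] //= lt_bn.
- by have [w ->] := bracket_tangle_0; rewrite scale1r.
- have [w _] := bracket_tangle_int b0; split=> //.
  by rewrite subr0 -bowtie_int bowtie0l.
have [|w e] := IH b; first by rewrite -ltnS ltnW.
have [wi _] := bracket_tangle_inv b1; have [wj _] := bracket_tangle_int b0.
have [w2 e2] := bracket_prod w wi; have [w3 e3] := bracket_sum w2 wj.
split=> //; rewrite e3 e2 -bowtie_int -star_inv -e starZl !bowtieZl !scalerA.
congr (_ *: _); rewrite opprB !exprzDr ?writhe_unit // -exprnP.
by congr (_ * _); rewrite mulrC -exprnN.
Qed.

(** * Strips of Farey triangles *)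

Local Open Scope nat_scope.

Lemma neq_negb (b s : bool) : b != s -> s = ~~ b.
Proof. by case: b s => [] []. Qed.

(** Sides are booleans, with [false] for left and [true] for right, so that each
statement covers its mirror image. *)
Definition vertex (s : bool) (t : triangle) : farey := if s then t.2 else t.1.
(** The triangle glued below [t] when the descent goes to the side [s].  Since
edges and triangles are both pairs of fractions, [turn s t] is at the same time
the edge from [vertex s t] to the bottom of [t], along which it is glued. *)
Definition turn (s : bool) (t : triangle) : triangle :=
  if s then (bottom t, t.2) else (t.1, bottom t).

(** The ancestor triangle of [apex t w], except that it starts from any triangle;
this generality makes it possible to remove the top triangle in inductions. *)
Fixpoint strip (t : triangle) (w : seq bool) : seq triangle :=
  t :: (if w is b :: w' then strip (turn b t) w' else [::]).
Fixpoint apex (t : triangle) (w : seq bool) : farey :=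
  if w is b :: w' then apex (turn b t) w' else bottom t.

Definition farey_pair (t : triangle) : bool :=
  t.1.2 * t.2.1 == t.1.1 * t.2.2 + 1.

(** The weight grows strictly along descents, so the age of a vertex can be read
off from its weight. *)
Definition wt (x : farey) : nat := x.1 + x.2.
Definition edge_wt (e : edge) : nat := maxn (wt e.1) (wt e.2).

Lemma farey_pair_turn s t : farey_pair t -> farey_pair (turn s t).
Proof.
by case: t s => [[a b] [c d]] [] /=; rewrite /farey_pair /= => /eqP H; apply/eqP; nia.
Qed.

Lemma wt_vertex s t : farey_pair t -> wt (vertex s t) < wt (bottom t).
Proof.
by case: t s => [[a b] [c d]] [] /=; rewrite /farey_pair /wt /= => /eqP H; nia.
Qed.

Lemma edge_wt_lt_bottom t : farey_pair t -> edge_wt t < wt (bottom t).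
Proof.
by move=> ft; rewrite /edge_wt gtn_max (wt_vertex true ft) (wt_vertex false ft).
Qed.

Lemma edge_wt_turn s t : farey_pair t -> edge_wt (turn s t) = wt (bottom t).
Proof.
move=> ft; have := wt_vertex s ft.
by case: s => /= /ltnW H; rewrite /edge_wt /= ?(maxn_idPl H) ?(maxn_idPr H).
Qed.

Lemma wt_bottom_turn s t : farey_pair t -> wt (bottom t) < wt (bottom (turn s t)).
Proof.
by move=> ft; rewrite -(edge_wt_turn s ft) edge_wt_lt_bottom ?farey_pair_turn.
Qed.

Lemma vertex_inj t r s : farey_pair t -> (vertex r t == vertex s t) = (r == s).
Proof.
move=> ft; have ne : t.1 != t.2.
  case: t ft => [[a b] [c d]]; rewrite /farey_pair /= => /eqP ft.
  by apply/eqP => -[? ?]; nia.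
by case: r s => [] []; rewrite /= ?eqxx // ?(negPf ne) // eq_sym (negPf ne).
Qed.

Lemma vertex_turn s t : vertex s (turn s t) = vertex s t.
Proof. by case: s. Qed.
Lemma vertex_turnC s t : vertex (~~ s) (turn s t) = bottom t.
Proof. by case: s. Qed.

Lemma turn_inj t r s : farey_pair t -> (turn r t == turn s t) = (r == s).
Proof.
move=> ft; have := wt_vertex true ft; have := wt_vertex false ft.
case: r s => [] []; rewrite ?eqxx //= => H1 H2; apply/negbTE/eqP.
  by move=> [H _]; rewrite H ltnn in H1.
by move=> [H _]; rewrite -H ltnn in H1.
Qed.

Lemma triangle_edgesE t :
  triangle_edges t = [:: t; turn false t; turn true t].
Proof. by case: t. Qed.

Lemma edge_of_step s t : farey_pair t ->
  (if flt (vertex s t) (bottom t) then (vertex s t, bottom t)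
   else (bottom t, vertex s t)) = turn s t.
Proof.
case: t s => [[a b] [c d]] [] /=; rewrite /farey_pair /flt /= => /eqP H.
  by rewrite ifF //; nia.
by rewrite ifT //; nia.
Qed.

(** Below the top edge every edge ends in a vertex born in the strip. *)
Lemma strip_edge t w u e : farey_pair t -> u \in strip t w ->
  e \in triangle_edges u -> (u = t /\ e = t) \/ wt (bottom t) <= edge_wt e.
Proof.
elim: w t => [|b w IH] t ft /=; rewrite in_cons => /orP[/eqP ->|].
- rewrite triangle_edgesE !inE => /or3P[] /eqP ->; first by left.
    by right; rewrite edge_wt_turn.
  by right; rewrite edge_wt_turn.
- by [].
- rewrite triangle_edgesE !inE => /or3P[] /eqP ->; first by left.
    by right; rewrite edge_wt_turn.
  by right; rewrite edge_wt_turn.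
- move=> ut' eu; right; have ft' := farey_pair_turn b ft.
  have [[_ ->]|] := IH _ ft' ut' eu; first by rewrite edge_wt_turn.
  by apply: leq_trans; rewrite ltnW ?wt_bottom_turn.
Qed.

(** Consequently the top triangle shares with the rest of the strip only the edge
along which they are glued. *)
Lemma strip_edge_turn b t w u e : farey_pair t ->
  u \in strip (turn b t) w -> e \in triangle_edges u ->
  (u = turn b t /\ e = turn b t) \/ wt (bottom t) < edge_wt e.
Proof.
move=> ft ut eu; have [|H] := strip_edge (farey_pair_turn b ft) ut eu.
  by left.
by right; apply: leq_trans H; apply: wt_bottom_turn.
Qed.

Lemma strip_bottom t w u : farey_pair t -> u \in strip t w ->
  wt (bottom t) <= wt (bottom u).
Proof.
move=> ft ut; have : turn true u \in triangle_edges u.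
  by rewrite triangle_edgesE !inE eqxx !orbT.
have fu : farey_pair u.
  elim: w t ft ut => [|b w IH] t ft /=; rewrite in_cons => /orP[/eqP ->|] //.
  by apply: IH; apply: farey_pair_turn.
move=> H; have := strip_edge ft ut H; rewrite edge_wt_turn // => -[[-> _]|] //.
Qed.

Lemma strip_vertex t w u s : farey_pair t -> u \in strip t w ->
  u = t \/ vertex s u \in [:: vertex s t; bottom t]
    \/ wt (bottom t) < wt (vertex s u).
Proof.
elim: w t => [|b w IH] t ft /=; rewrite in_cons => /orP[/eqP ->|] //; try by left.
move=> /(IH _ (farey_pair_turn b ft)); rewrite [_ \in [:: _; _]]inE.
move=> H; right; move: H => [->|[/orP[/eqP ->|]|H]].
- by left; rewrite !inE; case: (b); case: (s); rewrite /= eqxx ?orbT.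
- by left; rewrite !inE; case: (b); case: (s); rewrite /= eqxx ?orbT.
- by rewrite inE => /eqP ->; right; apply: wt_bottom_turn.
- by right; apply: leq_trans H; apply: ltnW; apply: wt_bottom_turn.
Qed.

(** * Oblique sides *)

Fixpoint side_edges (s : bool) (t : triangle) (w : seq bool) : seq edge :=
  if w is b :: w' then
    (if b != s then [:: turn s t] else [::]) ++ side_edges s (turn b t) w'
  else [:: turn s t].

Definition side_chain (s : bool) (t : triangle) (w : seq bool) : seq farey :=
  rcons (undup [seq vertex s u | u <- strip t w]) (apex t w).

(** If the strip turns to the side [s], its second triangle repeats the vertex on
that side, and the duplicate is dropped; otherwise that vertex is left for
good. *)
Lemma side_chain_cons s t b w : farey_pair t ->
  side_chain s t (b :: w) =
  (if b != s then [:: vertex s t] else [::]) ++ side_chain s (turn b t) w.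
Proof.
move=> ft; rewrite /side_chain /=.
suff -> : (vertex s t \in [seq vertex s u | u <- strip (turn b t) w]) = (b == s).
  by case: eqP.
have [->|nbs] := eqVneq b s.
  by case: (w) => [|? ?]; rewrite /= vertex_turn mem_head.
rewrite {nbs}(neq_negb nbs).
apply/negbTE/mapP => -[u ut e].
have lt1 := wt_vertex (~~ b) ft; have lt2 := wt_bottom_turn b ft.
have [ue|[|]] := strip_vertex (~~ b) (farey_pair_turn b ft) ut.
- by rewrite e ue vertex_turnC ltnn in lt1.
- rewrite -e vertex_turnC !inE => /orP[] /eqP H; first by rewrite H ltnn in lt1.
  by rewrite H in lt1; lia.
- by rewrite -e; lia.
Qed.

Lemma side_chain_head s t w : farey_pair t ->
  exists c, side_chain s t w = vertex s t :: c.
Proof.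
elim: w t => [|b w IH] t ft; first by exists [:: bottom t].
rewrite side_chain_cons //; have [c Hc] := IH _ (farey_pair_turn b ft).
have [e|_] := eqVneq b s; last by eexists.
by exists c; rewrite /= Hc e vertex_turn.
Qed.

Lemma chain_edges_cons2 x y g : chain_edges [:: x, y & g] =
  (if flt x y then (x, y) else (y, x)) :: chain_edges (y :: g).
Proof. by []. Qed.

Lemma side_chain_edges s t w : farey_pair t ->
  chain_edges (side_chain s t w) = side_edges s t w.
Proof.
elim: w t => [|b w IH] t ft.
  by rewrite /chain_edges /side_chain /= edge_of_step.
have ft' := farey_pair_turn b ft.
rewrite side_chain_cons //= -IH //.
have [//|nbs] := eqVneq b s; rewrite {nbs}(neq_negb nbs).
have [c ->] := side_chain_head (~~ b) w ft'.
by rewrite /= chain_edges_cons2 vertex_turnC edge_of_step.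
Qed.

Lemma side_edges_wt s t w e : farey_pair t -> e \in side_edges s t w ->
  wt (bottom t) <= edge_wt e.
Proof.
elim: w t => [|b w IH] t ft /=; first by rewrite inE => /eqP ->; rewrite edge_wt_turn.
rewrite mem_cat => /orP[|/(IH _ (farey_pair_turn b ft))].
  by case: ifP => //; rewrite inE => _ /eqP ->; rewrite edge_wt_turn.
by apply: leq_trans; apply: ltnW; apply: wt_bottom_turn.
Qed.

(** * Descending paths *)

(** From a top corner one can step to the bottom of the top triangle, or, if the
next triangle still has that corner, start the path there instead. *)
Fixpoint paths (s : bool) (t : triangle) (w : seq bool) : seq (seq farey) :=
  if w is b :: w' then
    map (cons (vertex s t)) (paths (~~ b) (turn b t) w')
    ++ (if s == b then paths b (turn b t) w' else [::])
  else [:: [:: vertex s t; bottom t]].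

Lemma paths_head s t w g : farey_pair t -> g \in paths s t w ->
  exists x g', [/\ g = [:: vertex s t, x & g']
    & {in x :: g', forall v, wt (bottom t) <= wt v}].
Proof.
elim: w s t g => [|b w IH] s t g ft /=.
  rewrite inE => /eqP ->; exists (bottom t), [::]; split=> // v.
  by rewrite inE => /eqP ->.
have lt := ltnW (wt_bottom_turn b ft); have ft' := farey_pair_turn b ft.
rewrite mem_cat => /orP[/mapP[g1 /(IH _ _ _ ft')[x [g' [-> H]]] ->]|].
  exists (bottom t), (x :: g'); rewrite vertex_turnC; split=> // v.
  by rewrite inE => /orP[/eqP ->//|/H]; apply: leq_trans.
case: eqP => // -> /(IH _ _ _ ft')[x [g' [-> H]]]; rewrite vertex_turn.
by exists x, g'; split=> // v /H; apply: leq_trans.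
Qed.

Lemma paths_uniq s t w : farey_pair t -> uniq (paths s t w).
Proof.
elim: w s t => [|b w IH] s t ft //=; have ft' := farey_pair_turn b ft.
rewrite cat_uniq map_inj_uniq ?IH //=; last by move=> ? ? [].
case: eqP => //= ->; rewrite IH // andbT.
apply/hasPn => g gb; apply/mapP => -[g1].
case/(paths_head ft') => x1 [g1' [-> _]] eg.
have [x [g' [e H]]] := paths_head ft' gb; move: e; rewrite eg => -[_ ex _].
have := H x (mem_head _ _); rewrite -ex vertex_turnC leqNgt.
by rewrite wt_bottom_turn.
Qed.

Definition parent_in (ts : seq triangle) (x w : farey) : bool :=
  has (fun t => (w == bottom t) && ((x == t.1) || (x == t.2))) ts.

Lemma parent_in_wt t w x y : farey_pair t -> parent_in (strip t w) x y ->
  wt (bottom t) <= wt y.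
Proof. by move=> ft /hasP[u ut /andP[/eqP -> _]]; apply: strip_bottom ut. Qed.

Lemma path_parent_wt t w x g : farey_pair t ->
  path (parent_in (strip t w)) x g -> {in g, forall v, wt (bottom t) <= wt v}.
Proof.
move=> ft; elim: g x => //= y g IH x /andP[/(parent_in_wt ft) xy /IH H] v.
by rewrite inE => /orP[/eqP ->|/H].
Qed.

Lemma apex_wt t w : farey_pair t -> wt (bottom t) <= wt (apex t w).
Proof.
elim: w t => //= b w IH t ft; apply: leq_trans (IH _ (farey_pair_turn b ft)).
exact/ltnW/wt_bottom_turn.
Qed.

(** After the first step all vertices are at least as heavy as the bottom of the
top triangle, so the later steps take place in the strip below. *)
Lemma mem_paths s t w g : farey_pair t ->
  (g \in paths s t w) =
  [&& ohead g == Some (vertex s t), sorted (parent_in (strip t w)) g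
    & last (vertex s t) g == apex t w].
Proof.
elim: w s t g => [|b w IH] s t g ft.
  rewrite /= inE; apply/eqP/and3P => [->|[]].
    by split; rewrite //= /parent_in /= eqxx; case: s; rewrite eqxx ?orbT.
  case: g => [|v [|x g]] //= /eqP[->] => [_|].
    by move/eqP => e; have := wt_vertex s ft; rewrite e ltnn.
  rewrite {1}/parent_in /= orbF => /andP[/andP[/eqP -> _]].
  case: g => [//|y g] /=; rewrite orbF => /andP[/andP[_]].
  by move/orP => [] /eqP e; [have := wt_vertex false ft|have := wt_vertex true ft];
     rewrite e ltnn.
have ft' := farey_pair_turn b ft.
have par_sub : subrel (parent_in (strip (turn b t) w)) (parent_in (strip t (b :: w))).
  by move=> x y xy; rewrite /parent_in /= -/(parent_in _ _ _) xy orbT.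
rewrite /= mem_cat; apply/orP/and3P => [[/mapP[g1 + ->]|]|].
- rewrite IH // vertex_turnC => /and3P[]; case: g1 => //= x g1 /eqP[->] sg l.
  split=> //; rewrite /= /parent_in /= (sub_path par_sub) // andbT eqxx.
  by case: (s); rewrite eqxx ?orbT.
- case: eqP => // ->; rewrite IH // vertex_turn => /and3P[hg sg l]; split=> //.
  exact: sub_sorted sg.
case: g => [|v [|x g]] /= [] // /eqP[->].
  by move=> _ /eqP e; have := apex_wt w ft'; rewrite -e; have := wt_vertex s ft;
     have := wt_bottom_turn b ft; lia.
case/andP=> px pg lg.
have xm : wt (bottom t) <= wt x by apply: (@parent_in_wt t (b :: w)) px.
have gm := @path_parent_wt t (b :: w) x g ft pg.
have pg' : path (parent_in (strip (turn b t) w)) x g.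
  have : {in [pred v | wt (bottom t) <= wt v] &,
     subrel (parent_in (strip t (b :: w))) (parent_in (strip (turn b t) w))}.
    move=> y z; rewrite !inE => Hy _ /=; rewrite /parent_in /= => /orP[|//].
    by case/andP=> _ /orP[] /eqP ey; move: Hy; rewrite ey leqNgt;
      [have -> := wt_vertex false ft|have -> := wt_vertex true ft].
  move/sub_in_path; apply; last exact: pg.
  by apply/allP => z; rewrite in_cons => /orP[/eqP ->|/gm].
case/orP: px => [/andP[/eqP ex _]|px].
  left; apply/mapP; exists (x :: g) => //.
  by rewrite IH // vertex_turnC ex /= eqxx -{1}ex pg' -ex.
right; case/hasP: (px) => u ut /andP[_ vu].
have lts := wt_vertex s ft; have ltb := wt_bottom_turn b ft.
have [r er] : exists r, vertex s t = vertex r u.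
  by case/orP: vu => /eqP ->; [exists false|exists true].
have : s = b; last first.
  by move=> e; subst s; rewrite eqxx IH // !vertex_turn /= eqxx px pg' lg.
have ltsb := ltn_trans lts ltb.
have [eu|[|]] := strip_vertex r ft' ut.
- move: er lts; rewrite eu; have [<-|nr] := eqVneq b r.
    by rewrite vertex_turn => /eqP; rewrite vertex_inj // => /eqP.
  by rewrite (neq_negb nr) vertex_turnC => ->; rewrite ltnn.
- rewrite -er !inE; have [<-|nr] := eqVneq b r.
    rewrite vertex_turn vertex_inj // => /orP[/eqP //|/eqP e].
    by rewrite e ltnn in ltsb.
  rewrite (neq_negb nr) vertex_turnC => /orP[] /eqP e.
    by rewrite e ltnn in lts.
  by rewrite e ltnn in ltsb.
- by rewrite -er => /(ltn_trans ltsb); rewrite ltnn.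
Qed.

(** * The two sides of a descending path *)

(** Tells whether [u] lies on the left of the path [g].  The vertices lighter than
the bottom of [u] are those present before [u] is added to the strip; the last of
them on [g] is a corner of [u], and [g] passes [u] along the side of that corner.
If it is the right corner, [u] lies on the left. *)
Definition side_of (g : seq farey) (u : triangle) : bool :=
  last f0 [seq v <- g | wt v < wt (bottom u)] == u.2.

Lemma filter_light (n : nat) (g : seq farey) : {in g, forall v, n <= wt v} ->
  [seq v <- g | wt v < n] = [::].
Proof.
move=> H; apply/eqP; rewrite -[_ == _]negbK -has_filter; apply/hasPn => v /H.
by rewrite -leqNgt.
Qed.

Lemma side_of_top s t w g : farey_pair t -> g \in paths s t w -> side_of g t = s.
Proof.
move=> ft /(paths_head ft)[x [g' [-> H]]].
rewrite /side_of /= wt_vertex // ltnNge H ?mem_head //= filter_light; last first.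
  by move=> v vg; apply: H; rewrite inE vg orbT.
by have := vertex_inj s true ft; rewrite /= => ->; case: (s).
Qed.

Lemma side_of_cons s b t w g u v : farey_pair t ->
  g \in paths s (turn b t) w -> u \in strip (turn b t) w ->
  side_of (v :: g) u = side_of g u.
Proof.
move=> ft gP ut; have ft' := farey_pair_turn b ft.
have [x [g' [-> _]]] := paths_head ft' gP.
have lt := leq_trans (wt_vertex s ft') (strip_bottom ft' ut).
by rewrite /side_of /= lt; case: ifP.
Qed.

Lemma chain_edges_paths s t w g e : farey_pair t -> g \in paths s t w ->
  e \in chain_edges g -> e = turn s t \/ wt (bottom t) < edge_wt e.
Proof.
elim: w s t g => [|b w IH] s t g ft /=.
  rewrite inE => /eqP ->; rewrite chain_edges_cons2 edge_of_step // inE => /eqP ->.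
  by left.
have ft' := farey_pair_turn b ft.
have up r g1 : g1 \in paths r (turn b t) w -> e \in chain_edges g1 ->
    wt (bottom t) < edge_wt e.
  move=> g1P /(IH _ _ _ ft' g1P)[->|]; first by rewrite edge_wt_turn ?wt_bottom_turn.
  by apply: ltn_trans; apply: wt_bottom_turn.
rewrite mem_cat => /orP[/mapP[g1 g1P ->]|]; last first.
  by case: ifP => // _ gP /(up _ _ gP); right.
have [x [g' [eg _]]] := paths_head ft' g1P; rewrite vertex_turnC in eg.
rewrite eg chain_edges_cons2 edge_of_step // inE -eg => /orP[/eqP|]; first by left.
by move/(up _ _ g1P); right.
Qed.

Lemma paths_consP s t b w g : farey_pair t -> g \in paths s t (b :: w) ->
  (exists2 g1, g1 \in paths (~~ b) (turn b t) w &
     g = vertex s t :: g1 /\ chain_edges g = turn s t :: chain_edges g1)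
  \/ (s = b /\ g \in paths b (turn b t) w).
Proof.
move=> ft; rewrite /= mem_cat => /orP[/mapP[g1 g1P ->]|]; last first.
  by case: eqP => // ->; right.
left; exists g1 => //; split=> //.
have [x [g' [-> _]]] := paths_head (farey_pair_turn b ft) g1P.
by rewrite vertex_turnC chain_edges_cons2 edge_of_step.
Qed.

(** The common form of the two kinds of paths: below the top triangle, [g] looks
like a path [g1] starting from side [k] of the next triangle. *)
Lemma path_step s t b w g : farey_pair t -> g \in paths s t (b :: w) ->
  exists k g1, [/\ g1 \in paths k (turn b t) w,
    {in strip (turn b t) w, side_of g =1 side_of g1},
    chain_edges g = (if k == b then [::] else [:: turn s t]) ++ chain_edges g1
    & k = b -> s = b].
Proof.
move=> ft gP.
have [[g1 g1P [eg ec]]|[es gb]] := paths_consP ft gP.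
  exists (~~ b), g1; split=> //; last by case: (b).
    by move=> u ut; rewrite eg (side_of_cons _ ft g1P).
  by rewrite ec; case: (b).
by exists b, g; rewrite eqxx.
Qed.

(** A triangle on the left of [g] has its right lower edge either inside the strip
or on [g]. *)
Lemma side_of_touching s t w g r u e : farey_pair t -> g \in paths s t w ->
  u \in strip t w -> e \in side_edges r t w -> e \in triangle_edges u ->
  e \notin chain_edges g -> side_of g u = ~~ r.
Proof.
elim: w s t g => [|b w IH] s t g ft gP ut er eu.
  move: ut er; rewrite /= !mem_seq1 => /eqP -> /eqP ->.
  move: (gP); rewrite /= mem_seq1 => /eqP eg.
  rewrite (side_of_top ft gP) eg chain_edges_cons2 edge_of_step // mem_seq1.
  by rewrite turn_inj // => /neq_negb.
have ft' := farey_pair_turn b ft.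
have [k [g1 [g1P eqs -> ks]]] := path_step ft gP.
rewrite mem_cat negb_or => /andP[e0 e1].
have above : u \in strip (turn b t) w -> e = turn b t \/ wt (bottom t) < edge_wt e.
  by move=> ut'; have [[_ ->]|] := strip_edge_turn ft ut' eu; [left|right].
have topE : u = t -> edge_wt e <= wt (bottom t).
  move=> ut'; move: eu; rewrite ut' triangle_edgesE !inE => /or3P[] /eqP ->.
  - by rewrite ltnW // edge_wt_lt_bottom.
  - by rewrite edge_wt_turn.
  - by rewrite edge_wt_turn.
move: er; rewrite /= mem_cat => /orP[|er].
  case: eqVneq => //= nbr; rewrite mem_seq1 => /eqP ee.
  have er : edge_wt e = wt (bottom t) by rewrite ee edge_wt_turn.
  move: ut; rewrite /= in_cons => /orP[/eqP ->|/above]; last first.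
    case=> [/eqP|]; last by rewrite er ltnn.
    by rewrite ee turn_inj // eq_sym (negPf nbr).
  rewrite (side_of_top ft gP); apply: neq_negb; apply: contraNneq e0 => rs.
  have [/ks sb|_] := eqVneq k b; last by rewrite mem_seq1 ee rs.
  by rewrite rs sb eqxx in nbr.
move: ut; rewrite /= in_cons => /orP[/eqP /topE|ut].
  by rewrite leqNgt (leq_trans (wt_bottom_turn b ft) (side_edges_wt ft' er)).
by rewrite eqs //; apply: IH g1P ut er eu e1.
Qed.

(** Only the edge between consecutive triangles has to be considered, and the side
changes there exactly if the path runs along that edge. *)
Lemma side_of_adjacent s t w g u u' e : farey_pair t -> g \in paths s t w ->
  u \in strip t w -> u' \in strip t w ->
  e \in triangle_edges u -> e \in triangle_edges u' ->
  e \notin chain_edges g -> side_of g u = side_of g u'.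
Proof.
elim: w s t g => [|b w IH] s t g ft gP.
  by rewrite /= !mem_seq1 => /eqP -> /eqP ->.
have ft' := farey_pair_turn b ft.
have [k [g1 [g1P eqs eg ks]]] := path_step ft gP.
have topE : e \in triangle_edges t -> edge_wt e <= wt (bottom t).
  rewrite triangle_edgesE !inE => /or3P[] /eqP ->.
  - by rewrite ltnW // edge_wt_lt_bottom.
  - by rewrite edge_wt_turn.
  - by rewrite edge_wt_turn.
have cross v : v \in strip (turn b t) w -> e \in triangle_edges t ->
    e \in triangle_edges v -> e \notin chain_edges g -> side_of g t = side_of g v.
  move=> vt /topE et ev; have [[ev' ee]|] := strip_edge_turn ft vt ev.
    2: by rewrite ltnNge et.
  rewrite (eqs v vt) (side_of_top ft gP) ev' (side_of_top ft' g1P) eg.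
  rewrite mem_cat negb_or => /andP[e0 _].
  have [kb|nkb] := eqVneq k b; first by rewrite kb ks.
  move: e0; rewrite (negPf nkb) mem_seq1 ee turn_inj // => bs.
  by rewrite (neq_negb bs); apply/esym/neq_negb; rewrite eq_sym.
rewrite /= !in_cons => /orP[/eqP ->|ut] /orP[/eqP ->|ut'] // eu eu' eng.
- exact: cross.
- by apply/esym/cross.
rewrite !eqs //; move: eng; rewrite eg mem_cat negb_or => /andP[_].
exact: IH g1P ut ut' eu eu'.
Qed.

(** Together with [side_of_touching] and [side_of_adjacent] this identifies the part
of the strip on the side [r] of [g].  Going down from a triangle on that side, one
meets a triangle with an edge on the oblique side [r], the bottom triangle at the
latest, and up to there the edges crossed are not on [g].  The property [K]
stands for belonging to that part. *)
Lemma side_of_reaches s t w g r (K : triangle -> Prop) :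
  farey_pair t -> g \in paths s t w ->
  (forall u e, u \in strip t w -> e \in side_edges r t w ->
     e \in triangle_edges u -> e \notin chain_edges g -> K u) ->
  (forall u u' e, u \in strip t w -> u' \in strip t w ->
     e \in triangle_edges u -> e \in triangle_edges u' ->
     e \notin chain_edges g -> K u' -> K u) ->
  {in strip t w, forall u, side_of g u = ~~ r -> K u}.
Proof.
elim: w s t g => [|b w IH] s t g ft gP Ktouch Kadj u.
  rewrite /= mem_seq1 => /eqP ->; rewrite (side_of_top ft gP) => sr.
  apply: (Ktouch t (turn r t)); rewrite ?mem_seq1 //=.
    by rewrite triangle_edgesE !inE; case: (r); rewrite eqxx ?orbT.
  move: gP; rewrite /= mem_seq1 => /eqP ->.
  rewrite chain_edges_cons2 edge_of_step // mem_seq1 turn_inj // sr.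
  by case: (r).
have ft' := farey_pair_turn b ft.
have [k [g1 [g1P eqs eg ks]]] := path_step ft gP.
have below v : v \in strip (turn b t) w -> side_of g v = ~~ r -> K v.
  move=> vt; rewrite eqs //; move: v vt; apply: (IH k _ g1) => //.
    move=> v e vt er ev eng; apply: (Ktouch v e) => //.
    - by rewrite /= in_cons vt orbT.
    - by rewrite /= mem_cat er orbT.
    - rewrite eg mem_cat (negPf eng) orbF; case: ifP => // _.
      rewrite mem_seq1; apply: contraTneq (side_edges_wt ft' er) => ->.
      by rewrite -ltnNge edge_wt_turn // wt_bottom_turn.
  move=> v v' e vt vt' ev ev' eng.
  have [-> //|nvv] := eqVneq v v'.
  apply: (Kadj v v' e); rewrite /= ?in_cons ?vt ?vt' ?orbT //.
  rewrite eg mem_cat (negPf eng) orbF; case: ifP => // _.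
  rewrite mem_seq1; apply: contra nvv => /eqP ee.
  have := strip_edge_turn ft vt ev; have := strip_edge_turn ft vt' ev'.
  by rewrite ee edge_wt_turn // ltnn => -[[-> _]|//] [[-> _]|//].
rewrite /= in_cons => /orP[/eqP -> {u}|]; last exact: below.
rewrite (side_of_top ft gP) => sr.
have Et c : turn c t \in triangle_edges t.
  by rewrite triangle_edgesE !inE; case: (c); rewrite eqxx ?orbT.
have notg1 x : x != b -> turn x t \notin chain_edges g1.
  move=> xb; apply/negP => /(chain_edges_paths ft' g1P).
  rewrite edge_wt_turn //; have := wt_bottom_turn b ft => lt [e|/(ltn_trans lt)].
    by have := edge_wt_turn x ft; rewrite e edge_wt_turn // => e'; rewrite e' ltnn in lt.
  by rewrite ltnn.
have [br|nbr] := eqVneq b r; last first.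
  apply: (Ktouch t (turn r t)); rewrite /= ?mem_head //.
    by rewrite nbr mem_head.
  rewrite eg mem_cat (negPf (notg1 r _)) 1?eq_sym // orbF.
  by case: ifP => // _; rewrite mem_seq1 turn_inj // sr; case: (r).
have nsb : s != b by rewrite sr br; case: (r).
have nkb : k != b by apply: contra nsb => /eqP /ks ->.
have top : turn b t \in strip (turn b t) w by case: (w) => *; rewrite /= mem_head.
have top' : turn b t \in strip t (b :: w) by rewrite /= in_cons top orbT.
have E' : turn b t \in triangle_edges (turn b t) by rewrite triangle_edgesE mem_head.
apply: (Kadj t (turn b t) (turn b t) (mem_head _ _) top' (Et b) E').
- rewrite eg (negPf nkb) mem_cat mem_seq1 turn_inj // eq_sym (negPf nsb) /=.
  apply/negP => /(chain_edges_paths ft' g1P); rewrite edge_wt_turn //.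
  case=> [e|/(ltn_trans (wt_bottom_turn b ft))]; last by rewrite ltnn.
  by have := wt_bottom_turn b ft; rewrite -(edge_wt_turn k ft') -e edge_wt_turn // ltnn.
- apply: below => //; rewrite eqs // (side_of_top ft' g1P) -br.
  by apply: neq_negb; rewrite eq_sym.
Qed.

(** * Path sums *)

Local Open Scope ring_scope.

Lemma size_strip t w : size (strip t w) = (size w).+1.
Proof. by elim: w t => //= b w IH t; rewrite IH. Qed.

Lemma size_side_edges s t w :
  size (side_edges s t w) = (count (predC1 s) w).+1.
Proof. by elim: w t => //= b w IH t; rewrite size_cat IH; case: ifP. Qed.

Lemma card_part (alpha : farey) s t w g r : farey_pair t ->
  ancestors alpha = strip t w -> g \in paths s t w ->
  #|part alpha (side_chain r t w) g| =
  count (fun u => side_of g u != r) (strip t w).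
Proof.
move=> ft eA gP.
pose T i := tnth (in_tuple (ancestors alpha)) i.
have Tin i : T i \in strip t w by rewrite -eA mem_tnth.
have -> : part alpha (side_chain r t w) g = [set i | side_of g (T i) != r]%SET.
  apply/setP => i; rewrite !inE; apply/existsP/idP.
    case=> j /andP[cij /hasP[e eT /andP[es eng]]].
    have cl : closed (fun a b => adjacent_off g (T a) (T b))
       [pred i | side_of g (T i) != r].
      move=> a b /hasP[e' ea /andP[eb eng']]; rewrite !inE.
      by rewrite (side_of_adjacent ft gP (Tin a) (Tin b) ea eb eng').
    move: (closed_connect cl cij); rewrite !inE => ->.
    rewrite side_chain_edges // in es.
    by rewrite (side_of_touching ft gP (Tin j) es eT eng); case: (r).
  move=> sr.
  pose K u := forall i, T i = u -> exists j,
    connect (fun a b => adjacent_off g (T a) (T b)) i j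
      && touches_off g (side_chain r t w) (T j).
  have Ku : K (T i); last exact: Ku i erefl.
  apply: (side_of_reaches (r := r) ft gP) => //
    [u e ut er eu eng j ej|u u' e ut ut' eu eu' eng Ku' j ej|].
  - exists j; rewrite connect0; apply/hasP; exists e; first by rewrite ej.
    by rewrite side_chain_edges // er.
  - rewrite -eA in ut'; have /tnthP[k ek] : u' \in in_tuple (ancestors alpha) := ut'.
    have [l /andP[ckl tl]] := Ku' k (esym ek).
    exists l; rewrite tl andbT; apply: connect_trans ckl; apply: connect1.
    by apply/hasP; exists e; rewrite ?ej // /T -ek eu'.
  - by case: (side_of _ _) (r) sr => [] [].
rewrite -eA -sum1_count big_tnth cardsE -sum1_card.
by apply: eq_bigl => i.
Qed.

Lemma descending_paths_strip (alpha : farey) s t w : farey_pair t ->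
  ancestors alpha = strip t w -> apex t w = alpha ->
  descending_paths (vertex s t) alpha = [set` paths s t w]%classic.
Proof.
move=> ft eA ea; have par : is_parent alpha = parent_in (strip t w) by rewrite -eA.
apply/seteqP; rewrite /descending_paths; split=> g /=; rewrite mem_paths // ea par.
  by case=> -> sg ->; rewrite !eqxx andbT.
by case/and3P => /eqP -> sg /eqP ->.
Qed.

Definition step_weight (s : bool) : laurent :=
  if s then - A ^+ 4 else (- A ^+ 4)^-1.

(** For [s = true] this is the sum over the paths from the upper right corner, with
the number of triangles on their right as exponents; for [s = false] it is the sum
over the paths from the upper left corner, with their left widths negated. *)
Definition path_sum s t w : laurent :=
  \sum_(g <- paths s t w)
    step_weight s ^+ count (fun u => side_of g u != s) (strip t w).

Lemma A4_unit : - A ^+ 4 \is a GRing.unit.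
Proof. by rewrite unitrN unitrX // A_unit. Qed.

Lemma step_weightN s : step_weight s * step_weight (~~ s) = 1.
Proof. by case: s; rewrite /= ?divrr ?mulVr ?A4_unit. Qed.

Lemma path_sum_nil s t : farey_pair t -> path_sum s t [::] = 1.
Proof.
move=> ft; rewrite /path_sum /= big_seq1 addn0.
by rewrite (side_of_top (w := [::]) ft (mem_head _ _)) eqxx expr0.
Qed.

(** Stepping to the bottom of the top triangle may change the starting side from [b]
to its opposite.  Since the two widths add up to the length of the strip, a sum over
widths on one side turns into one over widths on the other side at the cost of a
power of the weight. *)
Lemma path_sum_cons s t b w : farey_pair t ->
  path_sum s t (b :: w) =
  if s == b then
    path_sum b (turn b t) w
    + step_weight b ^+ (size w).+1 * path_sum (~~ b) (turn b t) w
  else path_sum (~~ b) (turn b t) w.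
Proof.
move=> ft; have ft' := farey_pair_turn b ft.
rewrite /path_sum [paths s t _]/= big_cat big_map [LHS]/=.
have -> : \sum_(g <- paths (~~ b) (turn b t) w)
    step_weight s ^+ count (fun u => side_of (vertex s t :: g) u != s) (strip t (b :: w))
  = \sum_(g <- paths (~~ b) (turn b t) w)
    step_weight s ^+ count (fun u => side_of g u != s) (strip (turn b t) w).
  apply: eq_big_seq => g gP; congr (_ ^+ _).
  have vgP : vertex s t :: g \in paths s t (b :: w).
    by rewrite /= mem_cat map_f.
  rewrite /= (side_of_top ft vgP) eqxx add0n; apply: eq_in_count => u ut.
  by rewrite (side_of_cons _ ft gP ut).
have [->|nsb] := eqVneq s b; last first.
  by rewrite big_nil addr0 (neq_negb (_ : b != s)) // eq_sym.
rewrite addrC; congr (_ + _).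
  apply: eq_big_seq => g gP; congr (_ ^+ _).
  have gP' : g \in paths b t (b :: w) by rewrite /= eqxx mem_cat gP orbT.
  by rewrite /= (side_of_top ft gP') eqxx.
rewrite big_distrr /=; apply: eq_bigr => g _.
rewrite -(size_strip (turn b t)) -(count_predC (fun u => side_of g u != ~~ b)).
rewrite exprD mulrAC -exprMn step_weightN expr1n mul1r.
by congr (_ ^+ _); apply: eq_count => u /=; case: (side_of _ _); case: (b).
Qed.

Fixpoint word_sum (s : bool) (w : seq bool) : laurent :=
  if w is b :: w' then
    if s == b then word_sum b w' + step_weight b ^+ (size w) * word_sum (~~ b) w'
    else word_sum (~~ b) w'
  else 1.

Lemma path_sumE s t w : farey_pair t -> path_sum s t w = word_sum s w.
Proof.
elim: w s t => [|b w IH] s t ft; first exact: path_sum_nil.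
by rewrite path_sum_cons // !IH ?farey_pair_turn.
Qed.

(** [phi] as a function of the word of turns; the counts of letters plus one are the
lengths of the right and of the left oblique side. *)
Definition phi_word (w : seq bool) : laurent2 :=
  vec (A ^+ 6 * (- A ^+ 4) ^- (count (predC1 true) w).+1 * word_sum true w)
      ((- A ^+ 4) ^+ (count (predC1 false) w).+1 * word_sum false w).

Lemma phi_pos_strip (alpha : farey) w :
  ancestors alpha = strip (f0, finf) w -> apex (f0, finf) w = alpha ->
  phi_pos alpha = phi_word w.
Proof.
move=> eA ea; have ft : farey_pair (f0, finf) by [].
have side r : rcons (undup [seq vertex r u | u <- ancestors alpha]) alpha =
   side_chain r (f0, finf) w by rewrite /side_chain eA ea.
have nbE r : size (chain_edges (side_chain r (f0, finf) w)) =
    (count (predC1 r) w).+1 by rewrite side_chain_edges // size_side_edges.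
have sumE s (F : seq farey -> laurent) :
   (forall g, F g = step_weight s ^+ #|part alpha (side_chain s (f0, finf) w) g|) ->
   \sum_(g \in descending_paths (vertex s (f0, finf)) alpha) F g = word_sum s w.
  move=> eF; rewrite (descending_paths_strip _ ft eA ea) -fsbig_seq ?paths_uniq //.
  rewrite -(path_sumE _ _ ft); apply: eq_big_seq => g gP.
  by rewrite eF (card_part _ ft eA gP).
rewrite /phi_pos /phi_word /nb_left /nb_right /left_side /right_side.
rewrite (side true) (side false) !nbE.
rewrite (sumE true) //; last by move=> g; rewrite /w_right /right_side (side true).
rewrite (sumE false) //; last first.
  by move=> g; rewrite /w_left /left_side (side false) -exprVn.
by rewrite basis_infE basis_0E !scale_vec add_vec !mulr1 !mulr0 addr0 add0r.
Qed.

Lemma count_turns w : (count (predC1 true) w + count (predC1 false) w = size w)%N.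
Proof. by elim: w => //= [] [] w; lia. Qed.

Lemma phi_word_nil : phi_word [::] = plus_one basis_0.
Proof.
rewrite /phi_word /plus_one basis_0E coef_inf_vec coef_0_vec /= expr1 mulr1.
have AB := A_mulV; congr vec.
rewrite invrN -exprVn; move: AB; set B := A^-1 => AB.
by ring: AB.
Qed.

(** The two lengths add up to the number of triangles plus one ([count_turns]); this
turns the power of the weight in [word_sum] into the factor [- A^2]. *)
Lemma phi_word_true w : phi_word (true :: w) = plus_one (phi_word w).
Proof.
rewrite /phi_word /plus_one coef_inf_vec coef_0_vec /= add0n -count_turns.
set P := word_sum true w; set Q := word_sum false w.
set m := count _ w; set n := count _ w.
have qK : (- A ^+ 4) ^- m.+1 * (- A ^+ 4) ^+ m.+1 = 1.
  by rewrite mulVr // unitrX ?A4_unit.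
congr vec; last by rewrite add1n exprS mulrA.
rewrite -addSn exprD mulrDr; congr (_ + _).
transitivity (A ^+ 6 * ((- A ^+ 4) ^- m.+1 * (- A ^+ 4) ^+ m.+1) * (- A ^+ 4) ^+ n * Q).
  by ring.
by rewrite qK (exprS _ n); ring.
Qed.

Lemma phi_word_false w : phi_word (false :: w) = inv_plus_one (phi_word w).
Proof.
rewrite /phi_word /inv_plus_one coef_inf_vec coef_0_vec /= add0n -count_turns.
set P := word_sum true w; set Q := word_sum false w.
set m := count _ w; set n := count _ w.
have qK : (- A ^+ 4) ^+ n.+1 * (- A ^+ 4)^-1 ^+ n.+1 = 1.
  by rewrite exprVn divrr // unitrX ?A4_unit.
congr vec; first by rewrite add1n -!exprVn !exprS; ring.
rewrite -addnS exprD mulrDr; congr (_ + _).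
transitivity (((- A ^+ 4) ^+ n.+1 * (- A ^+ 4)^-1 ^+ n.+1) * (- A ^+ 4)^-1 ^+ m * P).
  by ring.
rewrite qK mul1r -[(- A ^+ 4) ^- m.+1]exprVn (exprS _ m) invrN -!exprVn.
have := A_mulV; set B := A^-1 => AB.
by ring: AB.
Qed.

(** * Words and fractions *)

(** The multiplicities of the two corners of a triangle in the iterated Farey sum that
leads to the apex ([apexE]); they do not depend on the triangle. *)
Fixpoint mass (w : seq bool) : nat * nat :=
  if w is b :: w' then
    let: (p, r) := mass w' in if b then (p, p + r)%N else (p + r, r)%N
  else (1, 1)%N.

Lemma mass_gt0 w : (0 < (mass w).1)%N && (0 < (mass w).2)%N.
Proof. by elim: w => //= b w; case: (mass w) b => [p r] [] /=; lia. Qed.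

Lemma size_lt_mass w : ((size w).+1 < (mass w).1 + (mass w).2)%N.
Proof.
elim: w (mass_gt0 w) => //= b w; have := mass_gt0 w.
by case: (mass w) b => [p r] [] /=; lia.
Qed.

Lemma mass_coprime w : coprime (mass w).1 (mass w).2.
Proof.
elim: w => //= b w; case: (mass w) b => [p r] [] /= co; rewrite /coprime.
  by rewrite gcdnDl.
by rewrite gcdnC addnC gcdnDl gcdnC.
Qed.

Lemma apexE t w : apex t w =
  ((mass w).1 * t.1.1 + (mass w).2 * t.2.1, (mass w).1 * t.1.2 + (mass w).2 * t.2.2)%N.
Proof.
elim: w t => [|b w IH] [[y1 y2] [z1 z2]] /=.
  by rewrite /bottom /farey_sum /= !mul1n.
by rewrite IH; case: (mass w) b => [p r] [] /=; congr (_, _); lia.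
Qed.

Lemma descent_apex w t fuel : farey_pair t -> (size w < fuel)%N ->
  descent fuel (apex t w) t = strip t w.
Proof.
elim: w t fuel => [|b w IH] t [|fuel] //= ft lt_w; first by rewrite eqxx.
have ft' := farey_pair_turn b ft; congr cons.
case: eqP => [e|_].
  by have := apex_wt w ft'; rewrite -e leqNgt wt_bottom_turn.
have -> : flt (bottom t) (apex (turn b t) w) = b.
  rewrite apexE; case: t ft {ft'} => [[y1 y2] [z1 z2]]; rewrite /farey_pair /= => /eqP ft.
  have /andP[] := mass_gt0 w; case: (mass w) => p r /= p0 r0.
  by case: b; rewrite /flt /=; nia.
by rewrite -(IH _ fuel ft') //; case: b {IH ft'}.
Qed.

Lemma ancestors_apex w (alpha := apex (f0, finf) w) :
  ancestors alpha = strip (f0, finf) w.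
Proof.
apply: descent_apex => //; rewrite /alpha apexE /= !muln0 !muln1 add0n addn0.
by have := size_lt_mass w; lia.
Qed.

(** The fraction at the apex of the strip below the edge from 0 to infinity. *)
Definition word_value (w : seq bool) : rat := (mass w).2%:R / (mass w).1%:R.

Lemma word_value_gt0 w : 0 < word_value w.
Proof. by have /andP[p r] := mass_gt0 w; rewrite divr_gt0 ?ltr0n. Qed.

Lemma farey_of_word_value w : farey_of_rat (word_value w) = apex (f0, finf) w.
Proof.
rewrite apexE /= !muln0 !muln1 add0n addn0 /farey_of_rat /word_value.
have := mass_gt0 w; have := mass_coprime w; case: (mass w) => p r /= co /andP[p0 r0].
have co' : coprime `|r%:Z| `|p%:Z| by rewrite /= coprime_sym.
have := coprimeq_num co'; have := coprimeq_den co'.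
rewrite /= -!pmulrn => -> ->.
by rewrite gtr0_sg // mul1r (_ : (p%:Z == 0) = false) // eqz_nat gtn_eqF.
Qed.

Lemma phi_word_value w : phi (Some (word_value w)) = phi_word w.
Proof.
rewrite /phi gt_eqF ?word_value_gt0 // farey_of_word_value.
by rewrite (phi_pos_strip (ancestors_apex w)).
Qed.

Lemma word_value_true w : word_value (true :: w) = 1 + word_value w.
Proof.
rewrite /word_value /=; have /andP[+ _] := mass_gt0 w; case: (mass w) => p r /= p0.
by rewrite natrD mulrDl divff // pnatr_eq0 -lt0n.
Qed.

Lemma word_value_false w : word_value (false :: w) = (1 + (word_value w)^-1)^-1.
Proof.
rewrite /word_value /=; have /andP[] := mass_gt0 w; case: (mass w) => p r /= p0 r0.
have p1 : p%:R != 0 :> rat by rewrite pnatr_eq0 -lt0n.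
have r1 : r%:R != 0 :> rat by rewrite pnatr_eq0 -lt0n.
have pr1 : (p + r)%:R != 0 :> rat by rewrite pnatr_eq0 -lt0n addn_gt0 p0.
by rewrite natrD in pr1 *; field; rewrite ?p1 ?r1 ?pr1 ?[r%:R + _]addrC ?pr1.
Qed.

Lemma word_value_nseq_true k w :
  word_value (nseq k true ++ w) = k%:R + word_value w.
Proof.
elim: k => [|k IH] /=; first by rewrite add0r.
by rewrite word_value_true IH addrA nat1r.
Qed.

Lemma word_value_nseq_false k w :
  word_value (nseq k false ++ w) = (k%:R + (word_value w)^-1)^-1.
Proof.
elim: k => [|k IH] /=; first by rewrite add0r invrK.
by rewrite word_value_false IH invrK addrA nat1r.
Qed.

Lemma phi_word_nseq_true k w :
  phi_word (nseq k true ++ w) = iter k plus_one (phi_word w).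
Proof. by elim: k => //= k IH; rewrite phi_word_true IH. Qed.
Lemma phi_word_nseq_false k w :
  phi_word (nseq k false ++ w) = iter k inv_plus_one (phi_word w).
Proof. by elim: k => //= k IH; rewrite phi_word_false IH. Qed.

(** [b_0, ..., b_m] corresponds to [b_0] turns to the right, [b_1] to the left, and so
on.  The last block is shorter by one letter, because the empty word already stands
for the fraction 1. *)
Lemma word_of_expansion (b : seq nat) :
  odd (size b) -> all (leq 1) (behead b) -> b != [:: 0%N] ->
  exists2 w, word_value w = cfrac b & phi_word w = iterated_twist b.
Proof.
have [n] := ubnP (size b); elim: n b => [|n IH] [|b0 [|b1 b]] //=.
  case: b0 => // k _ _ _ _; exists (nseq k true ++ [::]).
    by rewrite word_value_nseq_true -natr1 /word_value /= divr1.
  by rewrite phi_word_nseq_true phi_word_nil -iterSr.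
move=> lt_bn ob /andP[b1p bp] _; rewrite negbK in ob.
have bhd : b != [:: 0%N] by apply: contraTneq bp => ->.
have [||w ev ew] := IH b _ ob _ bhd; first by rewrite -ltnS ltnW.
  by case: (b) bp => //= ? ? /andP[].
exists (nseq b0 true ++ nseq b1 false ++ w).
  rewrite word_value_nseq_true word_value_nseq_false ev.
  by rewrite -/(cfrac (b1 :: b)) cfrac_cons.
by rewrite phi_word_nseq_true phi_word_nseq_false ew.
Qed.

Lemma phi_cfrac (b : seq nat) : odd (size b) -> all (leq 1) (behead b) ->
  phi (Some (cfrac b)) = iterated_twist b.
Proof.
move=> ob bp; have [->|nb] := eqVneq b [:: 0%N]; first by [].
by have [w <- <-] := word_of_expansion ob bp nb; apply: phi_word_value.
Qed.

(** * Uniqueness of expansions *)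

Lemma cfrac_ge1 b : b != [::] -> all (leq 1) b -> 1 <= cfrac b.
Proof.
elim: b => // b0 b IH _ /= /andP[b0p bp]; rewrite -/(cfrac (b0 :: b)) cfrac_cons.
have b0R : 1 <= b0%:R :> rat by rewrite ler1n.
case: b IH bp => [|b1 b] IH bp; first by rewrite invr0 addr0.
rewrite -[leLHS]addr0; apply: lerD => //.
by rewrite invr_ge0; apply: le_trans (IH isT bp).
Qed.

Lemma natr_frac_inj (m n : nat) (x y : rat) :
  m%:R + x = n%:R + y -> `|x - y| < 1 -> m = n /\ x = y.
Proof.
move=> e; rewrite ltr_norml => /andP[h1 h2]; suff mn : m = n by move: e; rewrite mn => /addrI.
case: (ltngtP m n) => // lt_mn; move: lt_mn; rewrite -(ler_nat rat) -natr1 => ?;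
  exfalso; lra.
Qed.

(** Peel off two entries at a time.  The tail after an entry of even index is greater
than 1, so that entry is the integral part; the tail after an entry of odd index is at
least 1, with equality allowed, so the fractional parts range over the half-open
interval from 0 (excluded) to 1 (included), on which integral parts are again
determined. *)
Lemma even_expansion_unique b c (r : rat) :
  even_expansion_of b r -> even_expansion_of c r -> b = c.
Proof.
case=> ob bp eb [oc cp ec]; rewrite -{r}ec in eb.
have [n] := ubnP (size b).
elim: n b c ob bp oc cp eb => [|n IH] b c //.
have tailP x1 x : ~~ odd (size x).+1 -> (0 < x1)%N && all (leq 1) x ->
    [/\ 0 < (cfrac x)^-1 <= 1, 0 < (cfrac (x1 :: x))^-1 < 1 & odd (size x)].
  rewrite [odd _]/= negbK => ox /andP[x1p xp]; have x0 : x != [::] by case: x ox {xp}.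
  have z1 := cfrac_ge1 x0 xp; have z0 : 0 < cfrac x by apply: lt_le_trans z1.
  have i0 : 0 < (cfrac x)^-1 by rewrite invr_gt0.
  have i1 : (cfrac x)^-1 <= 1 by rewrite invf_le1.
  have x1R : 1 <= x1%:R :> rat by rewrite ler1n.
  have y1 : 1 < x1%:R + (cfrac x)^-1 by lra.
  have y0 := lt_trans ltr01 y1.
  by rewrite cfrac_cons i0 i1 invr_gt0 y0 invf_lt1.
case: b => [|b0 [|b1 b]] //; case: c => [|c0 [|c1 c]] //.
- by move=> _ _ _ _ /= /eqP; rewrite eqr_nat => /eqP ->.
- move=> _ _ oc cp; rewrite cfrac_cons (cfrac_cons c0) invr0.
  have [_ /andP[h0 h1] _] := tailP _ _ oc cp.
  by case/natr_frac_inj => [|_ e]; [rewrite ltr_norml|exfalso]; lra.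
- move=> ob bp _ _; rewrite cfrac_cons (cfrac_cons c0) invr0.
  have [_ /andP[h0 h1] _] := tailP _ _ ob bp.
  by case/natr_frac_inj => [|_ e]; [rewrite ltr_norml|exfalso]; lra.
move=> ob bp oc cp; rewrite cfrac_cons (cfrac_cons c0).
have [/andP[b0_ b1_] /andP[b2_ b3_] ob'] := tailP _ _ ob bp.
have [/andP[c0_ c1_] /andP[c2_ c3_] oc'] := tailP _ _ oc cp.
case/natr_frac_inj => [|-> /invr_inj]; first by rewrite ltr_norml; lra.
rewrite cfrac_cons (cfrac_cons c1).
case/natr_frac_inj => [|-> /invr_inj e lt_n]; first by rewrite ltr_norml; lra.
have tl y x : (0 < y)%N && all (leq 1) x -> all (leq 1) (behead x).
  by case/andP=> _; case: x => //= ? ? /andP[].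
suff -> : b = c by [].
by apply: IH (tl b1 b bp) oc' (tl c1 c cp) e _; rewrite // -ltnS ltnW.
Qed.

Lemma even_expansion_cfrac b : odd (size b) -> all (leq 1) (behead b) ->
  even_expansion (cfrac b) = b.
Proof.
move=> ob bp; have r0 : 0 <= cfrac b.
  case: b ob bp => // b0 b _ bp; rewrite cfrac_cons addr_ge0 // invr_ge0.
  have [-> //|bn] := eqVneq b [::].
  by apply: le_trans (cfrac_ge1 bn bp).
exact: even_expansion_unique (even_expansionP r0) (And3 ob bp erefl).
Qed.

Lemma phi_bracket (b : seq nat) : odd (size b) -> all (leq 1) (behead b) ->
  phi (Some (cfrac b)) =
  (- A ^+ 3) ^ alt_sum b *: bracket (rational_tangle (cfrac b)).
Proof.
move=> ob bp; rewrite phi_cfrac // /rational_tangle even_expansion_cfrac //.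
by have [_ ->] := bracket_tangle_of_seq b.
Qed.

Lemma alt_sumE (s : seq nat) n : size s = n ->
  \sum_(i < n) (-1) ^+ i * (nth 0%N s i)%:Z = alt_sum s.
Proof.
elim: s n => [|x s IH] [|n] //=; first by rewrite big_ord0.
case=> sn; rewrite big_ord_recl /= expr0 mul1r -(IH n sn) -sumrN; congr (_ + _).
by apply: eq_bigr => i _; rewrite /bump add1n exprS mulN1r mulNr.
Qed.

Lemma alt_sum_cat s t : alt_sum (s ++ t) = alt_sum s + (-1) ^+ size s * alt_sum t.
Proof. by elim: s => [|x s IH] /=; rewrite ?expr0 ?exprS ?IH; ring. Qed.

(** A final entry [k > 1] is split as [(k - 1) + 1/1]; a final 1 is absorbed into the
preceding entry. *)
Lemma odd_size_expansion s : ~~ odd (size s) -> (0 < size s)%N ->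
  all (leq 1) (behead s) ->
  exists b, [/\ odd (size b), all (leq 1) (behead b), cfrac b = cfrac s
    & alt_sum b = alt_sum s + 2].
Proof.
case/lastP: s => // s k; case/lastP: s => // q j.
rewrite !size_rcons /= negbK => oq _ sp.
have sgn : (-1) ^+ size q = 1 :> int by rewrite -signr_odd (negPf oq).
have kp : (0 < k)%N by case: (q) sp => [|? ?]; rewrite /= ?all_rcons => /andP[].
case: k kp sp => [|[|k]] // _ sp.
  exists (rcons q j.+1); rewrite cfrac_rcons1 size_rcons /= oq; split=> //.
    by case: (q) sp => [|? ?] //=; rewrite !all_rcons => /and3P[].
  by rewrite -!cats1 -catA !alt_sum_cat sgn /=; lia.
exists (rcons (rcons (rcons q j) k.+1) 1%N).
rewrite cfrac_rcons1 !size_rcons /= oq; split=> //.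
  by case: (q) sp => [|? ?] //=; rewrite !all_rcons => /andP[_ ->].
by rewrite -!cats1 -!catA !alt_sum_cat sgn /=; lia.
Qed.

Theorem theorem2p10 (n a0 : nat) (a : n.-tuple nat)
    (a_pos : forall i : 'I_n, (0 < tnth a i)%N) :
  let s : seq nat := a0 :: a in
  let e : int := \sum_(i < n.+1) (-1) ^+ i * (nth 0%N s i)%:Z in
  (~~ odd n ->
     phi (Some (cfrac s))
       = ((- A ^+ 3) ^ e : laurent) *: bracket (rational_tangle (cfrac s))) /\
  (odd n ->
     phi (Some (cfrac s))
       = ((- A ^+ 3) ^ (e + 2) : laurent) *: bracket (rational_tangle (cfrac s))).
Proof.
move=> s e; have size_s : size s = n.+1 by rewrite /= size_tuple.
have -> : e = alt_sum s by exact: alt_sumE.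
have sp : all (leq 1) (behead s) by apply/(all_tnthP (t := a)) => i; apply: a_pos.
split=> on; first by apply: phi_bracket; rewrite // size_s /= on.
have s_even : ~~ odd (size s) by rewrite size_s /= on.
have s_gt0 : (0 < size s)%N by rewrite size_s.
have [b [ob bp eb <-]] := odd_size_expansion s_even s_gt0 sp.
by rewrite -eb; apply: phi_bracket.
Qed.
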